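(* Let $G$ be a graph with positive integer edge weights and $m=\sum_j d_j$. Suppose a lazy random walk is run from a vertex $i$ for $\ell = \ln(m)/\zeta$ steps, for some constant $\zeta>0$, and let $p^\ell$ be the probability distribution induced on the final vertex. Let $\alpha = m^{-\tau}$, for a constant $\tau < 1$, be a given parameter such that $\zeta\tau < 1/8$, and let $\phi$ be chosen to satisfy $-\log\left(\tfrac{1}{2}\left(\sqrt{1-2\phi} + \sqrt{1+2\phi}\right)\right) = \zeta\tau$. Then there is an algorithm that, with probability $1-o(1)$, in $O(\log^4(n)/\alpha)$ time, either finds a set of vertices of conductance less than $\phi$, or declares correctly that $\max_j \frac{p^\ell_j}{2d_j} \leq 256\alpha$.
   Context: $G=(V,E)$ has $n$ vertices and positive integer edge weights $w_{jk}$ (equivalently, an unweighted multigraph). The (weighted) degree of $j$ is $d_j=\sum_{\{j,k\}\in E} w_{jk}$, and $m=\sum_j d_j$. A lazy random walk: at each step, from the current vertex $j$, with probability $1/2$ stay at $j$, and otherwise move to a neighbor $k$ chosen with probability $w_{jk}/d_j$ (so edge $\{j,k\}$ is traversed with overall probability $w_{jk}/(2d_j)$). For $S\subseteq V$, let $\bar S = V\setminus S$, $\mathrm{vol}(S)=\sum_{j\in S} d_j$, and define the weight $\mathrm{vol}'(S) = 2\,\mathrm{vol}(S)$ (accounting for self-loops of weight $d_j$ at each vertex). For a set $F$ of edges, $\mathrm{vol}'(F)=\sum_{e\in F} w_e$. Let $E(S,\bar S)$ be the set of edges crossing $(S,\bar S)$. The conductance of $S$ is $\phi_S = \frac{\mathrm{vol}'(E(S,\bar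 S))}{\min\{\mathrm{vol}'(S),\mathrm{vol}'(\bar S)\}}$. The algorithm has access to $G$ and can sample random walk steps. *)

(* Defs.v *)
From HB Require Import structures.
From mathcomp Require Import all_boot all_order all_algebra.
From mathcomp Require Import reals topology normedtype sequences exp.

Set Implicit Arguments.
Unset Strict Implicit.
Unset Printing Implicit Defensive.

Import Order.TTheory GRing.Theory Num.Theory.
Import numFieldNormedType.Exports.

Local Open Scope ring_scope.

(* A finite simple graph on the vertices 0, ..., n-1 with positive integer edge
   weights: {j, k} is an edge iff wt j k > 0. *)
Record wgraph (n : nat) := WGraph {
  wt : 'I_n -> 'I_n -> nat;
  wt_sym : forall j k, wt j k = wt k j;
  wt_irr : forall j, wt j j = 0%N
}.

Section Graph.
Variables (R : realType) (n : nat) (G : wgraph n).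

Definition deg (j : 'I_n) : nat := (\sum_(k < n) wt G j k)%N.

(* This is twice the total edge weight. *)
Definition total_deg : nat := (\sum_(j < n) deg j)%N.

Definition nbrs (j : 'I_n) : seq 'I_n := [seq k <- enum 'I_n | (0 < wt G j k)%N].

Definition lazy_mx : 'M[R]_n :=
  \matrix_(j, k) ((j == k)%:R / 2 + (wt G j k)%:R / (2 * (deg j)%:R)).

Definition walk_dist (i : 'I_n) (t : nat) : 'rV[R]_n :=
  iter t (fun p => p *m lazy_mx) (delta_mx 0 i).

(* vol' of a vertex set; the factor 2 accounts for the self-loops of the lazy
   walk. *)
Definition vol' (S : {set 'I_n}) : nat := (2 * \sum_(j in S) deg j)%N.

(* vol' of E(S, V \ S); each crossing edge is counted once, from its endpoint
   in S. *)
Definition cut_weight (S : {set 'I_n}) : nat :=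
  (\sum_(j in S) \sum_(k in ~: S) wt G j k)%N.

Definition conductance (S : {set 'I_n}) : R :=
  (cut_weight S)%:R / (minn (vol' S) (vol' (~: S)))%:R.

Definition max_ratio (i : 'I_n) (l : nat) : R :=
  \big[Num.max/0]_(j < n) (walk_dist i l 0 j / (2 * (deg j)%:R)).

End Graph.

(* The model of computation is a unit-cost random access machine.  It has a
   memory of natural numbers (with addition and truncated subtraction only) and
   a memory of exact real numbers (field operations and comparisons, no
   rounding), both of them indirectly addressable.  It reads the graph through
   degree, adjacency-list and edge-weight queries, and its only source of
   randomness is the sampling of lazy random walk steps.  The only constants of
   a program are natural numbers: real parameters must be given as inputs. *)

Inductive nexp :=
  | NCst of nat
  | NLoad of nexp
  | NAdd of nexp & nexp
  | NSub of nexp & nexp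
  | NDeg of nexp              (* weighted degree of a vertex *)
  | NNumNbr of nexp           (* length of its adjacency list *)
  | NNbr of nexp & nexp       (* NNbr v k: k-th neighbour of v *)
  | NWt of nexp & nexp.       (* weight of a pair of vertices, 0 if no edge *)

Inductive rexp :=
  | RNat of nexp
  | RLoad of nexp
  | RAdd of rexp & rexp
  | RSub of rexp & rexp
  | RMul of rexp & rexp
  | RDiv of rexp & rexp.

Inductive bexp :=
  | BNLt of nexp & nexp
  | BRLt of rexp & rexp
  | BNot of bexp
  | BAnd of bexp & bexp.

Inductive cmd :=
  | Skip
  | NStore of nexp & nexp     (* address, value *)
  | RStore of nexp & rexp     (* address, value *)
  | WalkStep of nexp & nexp   (* address for the result, current vertex *)
  | Emit of nexp              (* append a vertex to the output set *)
  | Seq of cmd & cmd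
  | If of bexp & cmd & cmd
  | While of bexp & cmd
  | FoundCut                  (* halt and return the emitted set *)
  | DeclareBound.             (* halt and declare that max_ratio is small *)

Inductive answer := Cut of seq nat | Bound.

Section Semantics.
Variables (R : realType) (n : nat) (G : wgraph n).

Record state := State {
  nmem : nat -> nat;
  rmem : nat -> R;
  emitted : seq nat
}.

Definition upd (T : Type) (f : nat -> T) (a : nat) (x : T) : nat -> T :=
  fun b => if b == a then x else f b.

(* Queries on numbers that are not vertices return 0. *)
Definition at_vertex (v : nat) (f : 'I_n -> nat) : nat :=
  if insub v is Some j then f j else 0%N.

Fixpoint neval (s : state) (e : nexp) : nat :=
  match e with
  | NCst k => k
  | NLoad a => nmem s (neval s a)
  | NAdd a b => (neval s a + neval s b)%N
  | NSub a b => (neval s a - neval s b)%N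
  | NDeg v => at_vertex (neval s v) (deg G)
  | NNumNbr v => at_vertex (neval s v) (fun j => size (nbrs G j))
  | NNbr v k => at_vertex (neval s v)
                  (fun j => nth 0%N (map val (nbrs G j)) (neval s k))
  | NWt u v => at_vertex (neval s u)
                 (fun j => at_vertex (neval s v) (wt G j))
  end.

Fixpoint reval (s : state) (e : rexp) : R :=
  match e with
  | RNat a => (neval s a)%:R
  | RLoad a => rmem s (neval s a)
  | RAdd a b => reval s a + reval s b
  | RSub a b => reval s a - reval s b
  | RMul a b => reval s a * reval s b
  | RDiv a b => reval s a / reval s b
  end.

Fixpoint beval (s : state) (b : bexp) : bool :=
  match b with
  | BNLt a b => (neval s a < neval s b)%N
  | BRLt a b => reval s a < reval s b
  | BNot a => ~~ beval s a
  | BAnd a b => beval s a && beval s b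
  end.

(* A running machine is given by the stack of commands still to be executed. *)
Inductive config :=
  | Running of seq cmd & state
  | Halted of answer.

Definition set_nmem (s : state) (a x : nat) : state :=
  State (upd (nmem s) a x) (rmem s) (emitted s).

Definition set_rmem (s : state) (a : nat) (x : R) : state :=
  State (nmem s) (upd (rmem s) a x) (emitted s).

(* One time unit, as a finite list of (probability, next configuration).  The
   expressions of a fixed program have bounded size, so they are evaluated in a
   single time unit. *)
Definition step (c : config) : seq (R * config) :=
  match c with
  | Halted _ | Running [::] _ => [:: (1, c)]
  | Running (k :: ks) s =>
    match k with
    | Skip => [:: (1, Running ks s)]
    | NStore a e => [:: (1, Running ks (set_nmem s (neval s a) (neval s e)))]
    | RStore a e => [:: (1, Running ks (set_rmem s (neval s a) (reval s e)))]
    | WalkStep a v =>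
        if insub (neval s v) is Some j then
          [seq (lazy_mx R G j u, Running ks (set_nmem s (neval s a) (val u)))
             | u <- enum 'I_n]
        else [:: (1, Running ks s)]
    | Emit v =>
        [:: (1, Running ks
                  (State (nmem s) (rmem s) (rcons (emitted s) (neval s v))))]
    | Seq k1 k2 => [:: (1, Running [:: k1, k2 & ks] s)]
    | If b k1 k2 => [:: (1, Running ((if beval s b then k1 else k2) :: ks) s)]
    | While b k1 =>
        [:: (1, Running (if beval s b then [:: k1, k & ks] else ks) s)]
    | FoundCut => [:: (1, Halted (Cut (emitted s)))]
    | DeclareBound => [:: (1, Halted Bound)]
    end
  end.

(* Probability that, after T time units, the machine has halted with an answer
   satisfying ok. *)
Fixpoint halt_prob (ok : pred answer) (T : nat) (c : config) : R :=
  match T with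
  | 0 => if c is Halted a then (ok a)%:R else 0
  | T'.+1 => \sum_(pc <- step c) pc.1 * halt_prob ok T' pc.2
  end.

(* Inputs: n, the total degree m, the starting vertex i and the walk length l
   in the first cells of the integer memory, alpha and phi in the first cells of
   the real memory; every other cell contains 0. *)
Definition init_state (i : 'I_n) (l : nat) (alpha phi : R) : state :=
  State (nth 0%N [:: n; total_deg G; val i; l]) (nth 0 [:: alpha; phi]) [::].

Definition init (prg : cmd) (i : 'I_n) (l : nat) (alpha phi : R) : config :=
  Running [:: prg] (init_state i l alpha phi).

(* The conductance is only meaningful for nonempty proper subsets. *)
Definition correct (i : 'I_n) (l : nat) (alpha phi : R) (a : answer) : bool :=
  match a with
  | Cut vs =>
      let S := finset (fun v : 'I_n => val v \in vs) in
      [&& all (fun v => (v < n)%N) vs, S != finset.set0, S != finset.setT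
        & conductance R G S < phi]
  | Bound => max_ratio R G i l <= 256 * alpha
  end.

End Semantics.

(* Main.v *)
Require Import Defs.
From HB Require Import structures.
From mathcomp Require Import all_boot all_order all_algebra.
From mathcomp Require Import reals topology normedtype sequences exp.
From mathcomp Require Import zify ring lra.

(* The random walk can be simulated deterministically.  Let [e = alpha / l] and
   at each step discard the mass of the vertices [u] carrying less than
   [2 * deg u * e]: since [deg] is stationary this loses at most [l * e = alpha]
   of the ratio [p u / (2 * deg u)], and the remaining vertices have volume at
   most [1 / e].  At every time the algorithm tests the level sets of this ratio
   at the thresholds [e * (1 + 1 / l) ^ k].  If none of them has conductance
   below [phi], a Lovasz-Simonovits argument bounds the mass of any fractional
   set of volume [x] at time [t] by [((1 + 1 / l) * lam) ^ t * sqrt x], where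
   [lam = (sqrt (1 - 2 phi) + sqrt (1 + 2 phi)) / 2 = exp (- zeta tau)]; at time
   [l] this is [O(alpha * sqrt x)].

   There are [O(l * log m)] thresholds per step and each costs [O(1 / e)], so
       the
   running time is [O(log^4 m / alpha)].  The weights are unbounded, hence
   [log m] need not be [O(log n)]; but if [m] exceeds a large power of [n], then
   bounding the cost of a test by the size [O(n^2)] of the graph is enough. *)

Import Order.TTheory GRing.Theory Num.Theory.
Import numFieldNormedType.Exports.

Set Implicit Arguments.
Unset Strict Implicit.
Unset Printing Implicit Defensive.

Local Open Scope ring_scope.

(** * Concavity of the square root *)

Section Concavity.
Variable R : realType.
Implicit Types (a b s x y c phi C : R).

(** After squaring, with [u] and [v] the two roots, the sides differ by
    [s * (1 - s) * (u - v) ^+ 2]. *)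
Lemma sqrt_concave a b s : 0 <= a -> 0 <= b -> 0 <= s <= 1 ->
  (1 - s) * Num.sqrt a + s * Num.sqrt b <= Num.sqrt ((1 - s) * a + s * b).
Proof.
move=> a0 b0 /andP[s0 s1].
have := sqr_sqrtr a0; have := sqr_sqrtr b0.
have := sqrtr_ge0 a; have := sqrtr_ge0 b.
move: (Num.sqrt a) (Num.sqrt b) => u v v0 u0 <- <-.
rewrite -[leLHS]ger0_norm; last by nra.
rewrite -sqrtr_sqr ler_wsqrtr //.
have : 0 <= s * (1 - s) * (u - v) ^+ 2.
  by rewrite mulr_ge0 ?sqr_ge0 ?mulr_ge0 ?subr_ge0.
rewrite -subr_ge0; set X := (X in 0 <= X); move=> h; rewrite -subr_ge0.
by set Y := (Y in 0 <= Y); have -> : Y = X by rewrite /X /Y; ring.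
Qed.

(** Meant for a set of volume [x] and cut weight [c]. The radicands on each side add up to [2 * x],
    so after squaring only their products matter: [x ^+ 2 - 4 * c ^+ 2] against
    [x ^+ 2 - 4 * (phi * x) ^+ 2]. *)
Lemma sqrtDsqrtB_le phi x c : 0 <= phi <= 1 / 2 -> 0 <= x -> phi * x <= c ->
  2 * c <= x ->
  Num.sqrt (x - 2 * c) + Num.sqrt (x + 2 * c) <=
  Num.sqrt x * (Num.sqrt (1 - 2 * phi) + Num.sqrt (1 + 2 * phi)).
Proof.
move=> /andP[p0 p1] x0 pc cx.
have c0 : 0 <= c by apply: le_trans pc; rewrite mulr_ge0.
rewrite mulrDr -!sqrtrM //.
have sqD u v : 0 <= u -> 0 <= v ->
    (Num.sqrt u + Num.sqrt v) ^+ 2 = u + v + 2 * Num.sqrt (u * v).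
  by move=> u0 v0; rewrite sqrrD !sqr_sqrtr // sqrtrM //; ring.
rewrite -(@ler_pXn2r _ 2) // ?nnegrE ?addr_ge0 ?sqrtr_ge0 //.
have h1 : 0 <= x * (1 - 2 * phi) by rewrite mulr_ge0 //; lra.
have h2 : 0 <= x * (1 + 2 * phi) by rewrite mulr_ge0 //; lra.
rewrite !sqD //; try lra.
have : Num.sqrt ((x - 2 * c) * (x + 2 * c)) <=
       Num.sqrt ((x * (1 - 2 * phi)) * (x * (1 + 2 * phi))).
  rewrite ler_wsqrtr //.
  have : (phi * x) ^+ 2 <= c ^+ 2.
    by rewrite ler_pXn2r ?nnegrE ?mulr_ge0.
  by rewrite !expr2 => ?; nra.
by move=> ?; nra.
Qed.

(* The left-hand side is concave and piecewise affine in [y], with breakpoints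
   at the [x k]; a chord of [sqrt] lies below [sqrt], so that it is enough to
   test the inequality at the breakpoints. *)
Lemma sum_min_le_sqrt (K : nat) (D x : 'I_K -> R) C :
  0 <= C -> (forall k, 0 <= D k) -> (forall k, 0 <= x k) ->
  (forall k, \sum_j D j * Num.min (x k) (x j) <= C * Num.sqrt (x k)) ->
  forall y, 0 <= y -> \sum_j D j * Num.min y (x j) <= C * Num.sqrt y.
Proof.
move=> C0 D0 x0 hx y y0.
pose h z := \sum_j D j * Num.min z (x j).
pose good z := (0 <= z) /\ (h z <= C * Num.sqrt z).
have hk k : good (x k) by split=> //; exact: hx.
(* [a] is the last breakpoint up to [y], or else [0], where both sides vanish. *)
have [a [ga ay amax]] : exists a, [/\ good a, a <= y &
    forall k, k \in enum 'I_K -> x k <= y -> x k <= a].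
  elim: (enum 'I_K) => [|k s [a [ga ay amax]]].
    exists 0; split=> //; split=> //.
    by rewrite sqrtr0 mulr0 /h big1 // => j _; rewrite min_l ?mulr0.
  have [xy|yx] := leP (x k) y; last first.
    exists a; split=> // j; rewrite inE => /orP[/eqP->|/amax//] xy.
    by have := lt_le_trans yx xy; rewrite ltxx.
  have [xa|ax] := leP (x k) a.
    by exists a; split=> // j; rewrite inE => /orP[/eqP->|/amax//].
  exists (x k); split=> // j; rewrite inE => /orP[/eqP->//|ij] xj.
  by rewrite (le_trans (amax _ ij xj)) // ltW.
(* [b] is the first breakpoint beyond [y]; without one the sum is constant from [a] on. *)
have [all_le|[b [gb yb bmin]]] : (forall k, k \in enum 'I_K -> x k <= y) \/
    exists b, [/\ good b, y < b &
      forall k, k \in enum 'I_K -> y < x k -> b <= x k].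
- elim: (enum 'I_K) => [|k s [al|[b [gb yb bmin]]]]; first by left.
    have [xy|yx] := leP (x k) y.
      by left=> j; rewrite inE => /orP[/eqP->|/al].
    right; exists (x k); split=> // j; rewrite inE => /orP[/eqP->//|/al].
    by rewrite ltNge => ->.
  right; have [xy|yx] := leP (x k) y.
    exists b; split=> // j; rewrite inE => /orP[/eqP->|/bmin//].
    by rewrite ltNge xy.
  have [xb|bx] := leP b (x k).
    by exists b; split=> // j; rewrite inE => /orP[/eqP->|/bmin//].
  exists (x k); split=> // j; rewrite inE => /orP[/eqP->//|ij] xj.
  by rewrite (le_trans (ltW bx)) // bmin.
- rewrite (_ : \sum_j _ = h a).
    by apply: le_trans ga.2 _; rewrite ler_wpM2l // ler_wsqrtr.
  apply: eq_bigr => j _; have xy := all_le j (mem_enum _ j).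
  by rewrite !min_r // amax ?mem_enum.
- have ab : 0 < b - a by rewrite subr_gt0 (le_lt_trans ay).
  pose s := (y - a) / (b - a).
  have s01 : 0 <= s <= 1.
    rewrite /s divr_ge0 ?(ltW ab) ?subr_ge0 //= ler_pdivrMr // mul1r.
    by rewrite lerB // ltW.
  have ys : y = (1 - s) * a + s * b.
    have : s * (b - a) = y - a by rewrite /s divfK // gt_eqF.
    by move=> ?; lra.
  rewrite (_ : \sum_j _ = (1 - s) * h a + s * h b); last first.
    rewrite /h !mulr_sumr -big_split /=; apply: eq_bigr => j _.
    have [xy|yx] := leP (x j) y.
      have xa := amax j (mem_enum _ j) xy.
      rewrite !min_r //; first ring.
      by rewrite (le_trans xy) // ltW.
    have bx := bmin j (mem_enum _ j) yx.
    rewrite (min_l (ltW (le_lt_trans ay yx))) (min_l bx) {1}ys; ring.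
  have [[a0 ha] [b0 hb]] := (ga, gb).
  have := sqrt_concave a0 b0 s01; rewrite -ys => hc.
  apply: (@le_trans _ _ (C * ((1 - s) * Num.sqrt a + s * Num.sqrt b))).
    have /andP[s0 s1] := s01.
    have : (1 - s) * h a <= (1 - s) * (C * Num.sqrt a).
      by rewrite ler_wpM2l ?subr_ge0.
    have : s * h b <= s * (C * Num.sqrt b) by rewrite ler_wpM2l.
    by move=> ? ?; lra.
  by rewrite ler_wpM2l.
Qed.

End Concavity.

(** * The lazy walk, its stationary measure and one Lovasz-Simonovits step *)

Section LazyWalk.
Variables (R : realType) (n : nat) (G : wgraph n).
Hypothesis deg_gt0 : forall j : 'I_n, (0 < deg G j)%N.

Local Notation M := (lazy_mx R G).

(** The degree with the self-loop counted: the unnormalised stationary measure of the walk, whose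
    sum over a set is [vol']. *)
Definition ldeg (j : 'I_n) : R := 2 * (deg G j)%:R.

Lemma ldegE j : ldeg j = 2 * (deg G j)%:R.
Proof. by []. Qed.

Lemma ldeg_ge1 j : 1 <= ldeg j.
Proof.
have : 1 <= (deg G j)%:R :> R by rewrite ler1n.
by rewrite /ldeg; lra.
Qed.

Lemma ldeg_gt0 j : 0 < ldeg j.
Proof. by rewrite (lt_le_trans ltr01) // ldeg_ge1. Qed.

Lemma lazy_mx_ge0 j k : 0 <= M j k.
Proof. by rewrite mxE addr_ge0 ?divr_ge0 // mulr_ge0. Qed.

Lemma sum_wt j : \sum_k (wt G j k)%:R = (deg G j)%:R :> R.
Proof. by rewrite natr_sum. Qed.

Lemma lazy_row_sum j : \sum_k M j k = 1.
Proof.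
under eq_bigr => k _ do rewrite mxE.
rewrite big_split /= -!mulr_suml (bigD1 j) //= eqxx big1 => [|k /negbTE kj].
  have : (deg G j)%:R != 0 :> R by rewrite pnatr_eq0 -lt0n.
  by rewrite sum_wt mulr1n => h; field.
by rewrite eq_sym kj.
Qed.

Lemma ldeg_stationary k : \sum_j ldeg j * M j k = ldeg k.
Proof.
rewrite (eq_bigr (fun j => (j == k)%:R * (deg G j)%:R + (wt G k j)%:R)).
  rewrite big_split /= sum_wt (bigD1 k) //= eqxx big1 => [|j /negbTE->].
    by rewrite mulr1n /ldeg; ring.
  by rewrite mul0r.
move=> j _; rewrite mxE (wt_sym G j k) /ldeg.
have : (deg G j)%:R != 0 :> R by rewrite pnatr_eq0 -lt0n.
by move: (j == k)%:R => x h; field.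
Qed.

Lemma vol'E (S : {set 'I_n}) : (vol' G S)%:R = \sum_(j in S) ldeg j :> R.
Proof. by rewrite /vol' natrM natr_sum mulr_sumr. Qed.

Lemma vol'_eq0 (S : {set 'I_n}) : (vol' G S == 0%N) = (S == finset.set0).
Proof.
apply/idP/eqP => [|->]; last by rewrite /vol' big_set0.
rewrite muln_eq0 /= sum_nat_eq0 => /forallP h; apply/setP => j.
rewrite inE; apply/negbTE/negP => jS.
by have := h j; rewrite jS /= eqn0Ngt deg_gt0.
Qed.

Lemma cut_weightC (S : {set 'I_n}) :
  (\sum_(u in ~: S) \sum_(v in S) wt G u v = cut_weight G S)%N.
Proof.
rewrite exchange_big; apply: eq_bigr => j _; apply: eq_bigr => k _.
exact: wt_sym.
Qed.

Section LovaszSimonovits.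
Variables (q : 'I_n -> R) (B : R) (S : {set 'I_n}).
Hypothesis qB : forall c : 'I_n -> R, (forall j, 0 <= c j <= 1) ->
  \sum_j c j * q j <= B * Num.sqrt (\sum_j c j * ldeg j).

(** The probability that a non-lazy step from [u] enters [S]. *)
Let a u : R := (\sum_(v in S) (wt G u v)%:R) / (deg G u)%:R.

Let a01 u : 0 <= a u <= 1.
Proof.
rewrite /a divr_ge0 ?sumr_ge0 //= ler_pdivrMr ?ltr0n // mul1r.
rewrite -sum_wt [leRHS](bigID (mem S)) /= lerDl sumr_ge0 //.
Qed.

Let a_ldeg u : a u * ldeg u = 2 * \sum_(v in S) (wt G u v)%:R.
Proof.
rewrite /a /ldeg; have : (deg G u)%:R != 0 :> R by rewrite pnatr_eq0 -lt0n.
by move=> h; field.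
Qed.

Let cutE : (cut_weight G S)%:R = \sum_(u in ~: S) \sum_(v in S) (wt G u v)%:R
    :> R.
Proof.
rewrite -cut_weightC natr_sum; apply: eq_bigr => u _; exact: natr_sum.
Qed.

Let c1_vol : \sum_(u in S) a u * ldeg u = (vol' G S)%:R - 2 * (cut_weight G
    S)%:R.
Proof.
apply/eqP; rewrite eq_sym subr_eq; apply/eqP.
rewrite vol'E /cut_weight natr_sum mulr_sumr -big_split /=.
apply: eq_bigr => u _; rewrite a_ldeg /ldeg -sum_wt (bigID (mem S)) /= mulrDr.
rewrite natr_sum; congr (_ + 2 * _); apply: eq_bigl => v; by rewrite inE.
Qed.

(** The difference is the volume of the fractional set that [a] defines on [S]. *)
Lemma cut_weight2_le : 2 * (cut_weight G S)%:R <= (vol' G S)%:R :> R.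
Proof.
rewrite -subr_ge0 -c1_vol sumr_ge0 // => u _.
by rewrite mulr_ge0 ?(ltW (ldeg_gt0 _)) //; case/andP: (a01 u).
Qed.

(* [q M (S)] is the half sum of the masses that [q] gives to two fractional
   sets: inside [S], the fraction of the edges staying in [S], and [S] itself
   enlarged by the fraction of the edges leading to [S]. *)
Lemma lovasz_simonovits :
  \sum_(v in S) \sum_u q u * M u v <=
  B / 2 * (Num.sqrt ((vol' G S)%:R - 2 * (cut_weight G S)%:R) +
           Num.sqrt ((vol' G S)%:R + 2 * (cut_weight G S)%:R)).
Proof.
pose c1 u := if u \in S then a u else 0.
pose c2 u := if u \in S then 1 else a u.
have c1P : \sum_u c1 u * ldeg u = (vol' G S)%:R - 2 * (cut_weight G S)%:R.
  rewrite -c1_vol [LHS](bigID (mem S)) /= [X in _ + X]big1 ?addr0.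
    by apply: eq_bigr => u uS; rewrite /c1 uS.
  by move=> u /negbTE uS; rewrite /c1 uS mul0r.
have c2P : \sum_u c2 u * ldeg u = (vol' G S)%:R + 2 * (cut_weight G S)%:R.
  rewrite [LHS](bigID (mem S)) /= vol'E cutE mulr_sumr; congr (_ + _).
    by apply: eq_bigr => u uS; rewrite /c2 uS mul1r.
  apply: eq_big => [u|u /negbTE uS]; first by rewrite inE.
  by rewrite /c2 uS a_ldeg.
(* [c1 u + c2 u] is [a u] plus the indicator of [S], twice the probability of a lazy step from [u]
   into [S]. *)
have -> : \sum_(v in S) \sum_u q u * M u v =
    (\sum_u c1 u * q u + \sum_u c2 u * q u) / 2.
  rewrite exchange_big /= -big_split /= mulr_suml; apply: eq_bigr => u _.
  rewrite -mulr_sumr (eq_bigr (fun v => (u == v)%:R / 2 +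
            (wt G u v)%:R / (2 * (deg G u)%:R))); last by move=> v _;
                rewrite mxE.
  rewrite big_split /= -!mulr_suml.
  have -> : \sum_(v in S) (u == v)%:R = (u \in S)%:R :> R.
    have [uS|uS] := boolP (u \in S).
      rewrite (bigD1 u) //= eqxx big1 ?addr0 // => v /andP[_ /negbTE].
      by rewrite eq_sym => ->.
    rewrite big1 // => v vS; case: eqP => // uv; by rewrite uv vS in uS.
  have h : (deg G u)%:R != 0 :> R by rewrite pnatr_eq0 -lt0n.
  by rewrite /c1 /c2 /a; case: (u \in S); rewrite ?mulr1n ?mulr0n; field.
have /qB : forall j, 0 <= c1 j <= 1.
  by move=> j; rewrite /c1; case: ifP => _; [exact: a01|rewrite lexx ler01].
rewrite c1P.
have /qB : forall j, 0 <= c2 j <= 1.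
  by move=> j; rewrite /c2; case: ifP => _; [rewrite lexx ler01|exact: a01].
by rewrite c2P; lra.
Qed.

End LovaszSimonovits.

End LazyWalk.

(** * The truncated walk and its level sets *)

Section TruncatedWalk.
Variables (R : realType) (n : nat) (G : wgraph n).
Hypothesis deg_gt0 : forall j : 'I_n, (0 < deg G j)%N.
Variables (i : 'I_n) (e : R).
Hypothesis e_gt0 : 0 < e.

Local Notation M := (lazy_mx R G).
Local Notation ldeg := (ldeg R G).

Fixpoint twalk (t : nat) : 'I_n -> R :=
  match t with
  | 0 => fun j => (j == i)%:R
  | t'.+1 => fun v =>
      \sum_(u | ldeg u * e <= twalk t' u) twalk t' u * M u v
  end.

Definition level (t : nat) (th : R) : {set 'I_n} :=
  finset (fun u => ldeg u * th <= twalk t u).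

Definition truncated (t : nat) (u : 'I_n) : R :=
  if u \in level t e then twalk t u else 0.

Lemma twalkS t v : twalk t.+1 v = \sum_u truncated t u * M u v.
Proof.
rewrite /= big_mkcond; apply: eq_bigr => u _.
by rewrite /truncated inE; case: ifP => // _; rewrite mul0r.
Qed.

Lemma twalk_ge0 t v : 0 <= twalk t v.
Proof.
elim: t v => [|t IH] v; first by rewrite /=.
by rewrite /= sumr_ge0 // => u _; rewrite mulr_ge0 // lazy_mx_ge0.
Qed.

Lemma truncated_ge0 t v : 0 <= truncated t v.
Proof. by rewrite /truncated; case: ifP => // _; exact: twalk_ge0. Qed.

Lemma truncated_le t v : truncated t v <= twalk t v.
Proof. by rewrite /truncated; case: ifP => // _; exact: twalk_ge0. Qed.

Lemma sum_twalk_le1 t : \sum_v twalk t v <= 1.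
Proof.
elim: t => [|t IH].
  by rewrite (bigD1 i) //= eqxx big1 ?addr0 // => v /negbTE->.
under eq_bigr => v _ do rewrite twalkS.
rewrite exchange_big /= (le_trans _ IH) // ler_sum // => u _.
by rewrite -mulr_sumr lazy_row_sum // mulr1 truncated_le.
Qed.

Lemma twalk_le1 t v : twalk t v <= 1.
Proof.
apply: le_trans (sum_twalk_le1 t).
by rewrite [leRHS](bigD1 v) //= lerDl sumr_ge0 // => u _; exact: twalk_ge0.
Qed.

(** Markov's inequality: each vertex of the level set carries at least [th * ldeg u], out of a total
    mass of at most 1. *)
Lemma vol'_level_le t th : 0 <= th -> th * (vol' G (level t th))%:R <= 1.
Proof.
move=> th0; rewrite vol'E mulr_sumr (le_trans _ (sum_twalk_le1 t)) //.
rewrite [leRHS](bigID (mem (level t th))) /= -[leLHS]addr0 lerD //.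
  by apply: ler_sum => u; rewrite inE mulrC.
by rewrite sumr_ge0 // => u _; exact: twalk_ge0.
Qed.

Lemma twalk_le_truncated t u : twalk t u <= truncated t u + e * ldeg u.
Proof.
rewrite /truncated inE; case: (leP (ldeg u * e)) => [_|/ltW].
  by rewrite lerDl mulr_ge0 // ltW // ldeg_gt0.
by rewrite /= add0r mulrC.
Qed.

(** One truncation lowers each mass by at most [e * ldeg]. As [ldeg] is stationary, [M] does not
    amplify the error of earlier steps, and the losses just add up. *)
Lemma walk_dist_le t v :
  walk_dist R G i t 0 v <= twalk t v + t%:R * e * ldeg v.
Proof.
elim: t v => [|t IH] v.
  by rewrite /walk_dist /= !mul0r addr0 mxE eqxx.
rewrite {1}/walk_dist iterS -/(walk_dist R G i t) mxE twalkS.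
rewrite -(ldeg_stationary R deg_gt0) mulr_sumr -big_split /=.
apply: ler_sum => u _; rewrite mulrA -mulrDl ler_wpM2r ?lazy_mx_ge0 //.
apply: (le_trans (IH u)).
by have := twalk_le_truncated t u; rewrite -natr1; lra.
Qed.

Section LevelSets.
Variables (g : R) (K : nat).
Hypothesis g_ge1 : 1 <= g.

(** Geometric thresholds; the increments [inc] telescope to them, which turns a threshold into a sum
    over the level sets containing a vertex. *)
Let theta k := e * g ^+ k.
Let inc k := theta k - (if k is k'.+1 then theta k' else 0).

Let theta_gt0 k : 0 < theta k.
Proof. by rewrite mulr_gt0 // exprn_gt0 // (lt_le_trans ltr01). Qed.

Let theta_le j k : (j <= k)%N -> theta j <= theta k.
Proof. by move=> jk; rewrite ler_wpM2l ?(ltW e_gt0) // ler_weXn2l. Qed.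

Let inc_ge0 k : 0 <= inc k.
Proof.
by case: k => [|k]; rewrite /inc subr_ge0;
    [exact/ltW/theta_gt0|exact: theta_le].
Qed.

Let sum_inc k : \sum_(j < k.+1) inc j = theta k.
Proof.
elim: k => [|k IH]; first by rewrite big_ord1 /inc subr0.
by rewrite big_ord_recr /= IH /inc; ring.
Qed.

(** The mass of [u] rounded down to [ldeg u] times one of the [K] thresholds (0 below the first), in
    layer-cake form so that the mass of a set becomes a sum over level sets. *)
Let rounded t u := ldeg u * \sum_(k < K) inc k * (u \in level t (theta k))%:R.

Let sum_inc_level t u k : u \in level t (theta k) ->
  \sum_(j < k.+1) inc j * (u \in level t (theta j))%:R = theta k.
Proof.
rewrite inE => h; rewrite -[RHS]sum_inc; apply: eq_bigr => j _.
rewrite inE (le_trans _ h) ?mulr1 //.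
by rewrite ler_wpM2l ?(ltW (ldeg_gt0 _ _ _)) // theta_le // -ltnS.
Qed.

Let rounded_le t u : rounded t u <= twalk t u.
Proof.
rewrite /rounded; elim: K => [|k IH]; first by rewrite big_ord0 mulr0 twalk_ge0.
have [h|/negbTE h] := boolP (u \in level t (theta k)).
  by rewrite sum_inc_level //; rewrite inE in h.
by rewrite big_ord_recr /= h mulr0 addr0.
Qed.

(** Consecutive thresholds differ by the factor [g]; ratios below the first are truncated, and none
    reaches [theta K]. *)
Let le_rounded t u : 1 <= theta K -> truncated t u <= g * rounded t u.
Proof.
move=> K1; have : twalk t u < ldeg u * theta K.
  have u1 : twalk t u <= 1 := twalk_le1 t u.
  have : 1 < ldeg u.
    have : 1 <= (deg G u)%:R :> R by rewrite ler1n.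
    by rewrite ldegE; lra.
  by move=> ?; nra.
rewrite /rounded; elim: K => [|k IH] h.
  rewrite big_ord0 !mulr0 /truncated ifN // inE -ltNge.
  by move: h; rewrite /theta expr0 mulr1.
have [uk|/negbTE uk] := boolP (u \in level t (theta k)).
  rewrite sum_inc_level // (le_trans (truncated_le _ _)) // (le_trans (ltW h))
      //.
  by rewrite /theta exprS; lra.
by rewrite big_ord_recr /= uk mulr0 addr0 IH // ltNge; move: uk;
    rewrite inE => ->.
Qed.

(** Rounding to the thresholds costs the factor [g]. On each level set the cut hypothesis gains the
    factor [lam] through [sqrtDsqrtB_le]; then [sum_min_le_sqrt], with the volumes of the level sets
    as breakpoints, carries the bound over to all fractional sets. *)
Lemma lovasz_simonovits_step t (phi lam B : R) :
  0 <= phi <= 1 / 2 ->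
  lam = 1 / 2 * (Num.sqrt (1 - 2 * phi) + Num.sqrt (1 + 2 * phi)) ->
  0 <= B -> 1 <= theta K ->
  (forall k, theta k < 1 ->
     phi * (vol' G (level t.+1 (theta k)))%:R <=
     (cut_weight G (level t.+1 (theta k)))%:R) ->
  (forall c : 'I_n -> R, (forall j, 0 <= c j <= 1) ->
     \sum_j c j * truncated t j <= B * Num.sqrt (\sum_j c j * ldeg j)) ->
  forall c : 'I_n -> R, (forall j, 0 <= c j <= 1) ->
    \sum_j c j * truncated t.+1 j <=
    g * lam * B * Num.sqrt (\sum_j c j * ldeg j).
Proof.
move=> phi01 lamE B0 K1 hcut hB c c01.
have lam0 : 0 <= lam.
  by rewrite lamE mulr_ge0 ?divr_ge0 ?addr_ge0 ?sqrtr_ge0.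
pose x (k : 'I_K) : R := (vol' G (level t.+1 (theta k)))%:R.
have levelB k : \sum_(v in level t.+1 (theta k)) twalk t.+1 v <=
    lam * B * Num.sqrt (vol' G (level t.+1 (theta k)))%:R.
  set S := level t.+1 (theta k).
  have phiS : phi * (vol' G S)%:R <= (cut_weight G S)%:R.
    have [/hcut //|th1] := ltP (theta k) 1.
    (* A positive volume is at least 2, while threshold times volume is at most 1. *)
    suff /eqP -> : vol' G S == 0%N by rewrite mulr0.
    have := vol'_level_le t.+1 (ltW (theta_gt0 k)); rewrite -/S => h.
    rewrite -leqn0 leqNgt; apply/negP => v0.
    have : 2 <= (vol' G S)%:R :> R.
      by rewrite ler_nat; move: v0; rewrite /vol'; lia.
    by move=> ?; nra.
  under eq_bigr => v _ do rewrite twalkS.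
  apply: le_trans (lovasz_simonovits deg_gt0 S hB) _.
  have := sqrtDsqrtB_le phi01 (ler0n _ _) phiS (cut_weight2_le R deg_gt0 S).
  move=> /(ler_wpM2l (_ : 0 <= B / 2)) h.
  apply: le_trans (h _) _; first by rewrite divr_ge0.
  by rewrite lamE le_eqVlt; apply/orP; left; apply/eqP; field.
apply: (@le_trans _ _ (g * \sum_j c j * rounded t.+1 j)).
  rewrite mulr_sumr ler_sum // => j _.
  rewrite mulrCA ler_wpM2l ?le_rounded //.
  by case/andP: (c01 j).
rewrite -!mulrA ler_wpM2l ?(le_trans ler01) //.
set y := \sum_j c j * ldeg j.
have y0 : 0 <= y.
  rewrite sumr_ge0 // => j _; rewrite mulr_ge0 ?(ltW (ldeg_gt0 _ _ _)) //.
  by case/andP: (c01 j).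
rewrite mulrA.
apply: le_trans (sum_min_le_sqrt (D := fun k : 'I_K => inc k) (x := x) _ _ _ _
    y0).
(* Layer [k] contributes at most the smaller of the volume of [c] and that of its level set. *)
- rewrite /rounded.
  under eq_bigr => j _ do rewrite mulrA mulr_sumr.
  rewrite exchange_big /= ler_sum // => k _.
  under eq_bigr => j _ do rewrite mulrCA.
  rewrite -mulr_sumr ler_wpM2l // le_min; apply/andP; split.
    apply: ler_sum => j _; rewrite ler_piMr ?lern1 ?leq_b1 //.
    rewrite mulr_ge0 ?(ltW (ldeg_gt0 _ _ _)) //; by case/andP: (c01 j).
  rewrite /x vol'E [leRHS]big_mkcond; apply: ler_sum => j _.
  case: ifP => _; rewrite ?mulr0 // mulr1 ler_piMl ?(ltW (ldeg_gt0 _ _ _)) //.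
  by case/andP: (c01 j).
- by rewrite mulr_ge0.
- by move=> k; exact: inc_ge0.
- by move=> k; exact: ler0n.
(* Level sets are nested, so the smaller of two volumes is that of their intersection, and the sum
   is at most the rounded mass of level set [k]. *)
- move=> k; apply: le_trans (levelB k).
  apply: (@le_trans _ _ (\sum_(u in level t.+1 (theta k)) rounded t.+1 u));
      last first.
    by apply: ler_sum => u _; exact: rounded_le.
  rewrite /rounded; under [leRHS]eq_bigr => j _ do rewrite mulr_sumr.
  rewrite exchange_big /= ler_sum // => j _.
  under eq_bigr => u _ do rewrite mulrCA.
  rewrite -mulr_sumr ler_wpM2l // /x.
  have level_sub a b : (a <= b)%N ->
      level t.+1 (theta b) \subset level t.+1 (theta a).
    move=> ab; apply/subsetP => u; rewrite !inE; apply: le_trans.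
    by rewrite ler_wpM2l ?(ltW (ldeg_gt0 _ _ _)) // theta_le.
  have [jk|/ltnW kj] := leqP j k.
    rewrite ge_min vol'E; apply/orP; left; apply: ler_sum => u uk.
    by rewrite (subsetP (level_sub _ _ jk) _ uk) mulr1.
  rewrite ge_min !vol'E; apply/orP; right.
  rewrite [leLHS]big_mkcond [leRHS]big_mkcond; apply: ler_sum => u _.
  have [uj|uj] := boolP (u \in level t.+1 (theta j)).
    by rewrite (subsetP (level_sub _ _ kj) _ uj) mulr1.
  by case: ifP; rewrite ?mulr0.
Qed.

(** The left-hand side is at most [c i], and [c i ^+ 2 <= c i * ldeg i] because
    [c i <= 1 <= ldeg i]. *)
Lemma truncated0_le (c : 'I_n -> R) : (forall j, 0 <= c j <= 1) ->
  \sum_j c j * truncated 0 j <= Num.sqrt (\sum_j c j * ldeg j).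
Proof.
move=> c01; have [ci0 ci1] := andP (c01 i).
apply: (@le_trans _ _ (c i)).
  rewrite (bigD1 i) //= big1 ?addr0.
    by rewrite ler_piMr // (le_trans (truncated_le _ _)) //= eqxx.
  move=> j /negbTE ji; suff -> : truncated 0 j = 0 by rewrite mulr0.
  by apply/eqP; rewrite eq_le truncated_ge0 andbT (le_trans (truncated_le _ _))
      //= ji.
rewrite -[leLHS]ger0_norm // -sqrtr_sqr ler_wsqrtr //.
rewrite (bigD1 i) //= -[leLHS]addr0 lerD //.
  by have := ldeg_ge1 R deg_gt0 i; rewrite expr2 => ?; nra.
rewrite sumr_ge0 // => j _; rewrite mulr_ge0 ?(ltW (ldeg_gt0 _ _ _)) //.
by case/andP: (c01 j).
Qed.

Lemma truncated_le_sqrt l (phi lam : R) :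
  0 <= phi <= 1 / 2 ->
  lam = 1 / 2 * (Num.sqrt (1 - 2 * phi) + Num.sqrt (1 + 2 * phi)) ->
  1 <= theta K ->
  (forall t k, (0 < t <= l)%N -> theta k < 1 ->
     phi * (vol' G (level t (theta k)))%:R <=
     (cut_weight G (level t (theta k)))%:R) ->
  forall c : 'I_n -> R, (forall j, 0 <= c j <= 1) ->
    \sum_j c j * truncated l j <=
    (g * lam) ^+ l * Num.sqrt (\sum_j c j * ldeg j).
Proof.
move=> phi01 lamE K1; elim: l => [|l IH] hcut c c01.
  by rewrite expr0 mul1r truncated0_le.
rewrite exprS.
apply: (lovasz_simonovits_step phi01 lamE) => // [|k|c' c'01].
- rewrite exprn_ge0 // mulr_ge0 //; first exact: le_trans ler01 _.
  by rewrite lamE mulr_ge0 ?divr_ge0 ?addr_ge0 ?sqrtr_ge0.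
- by apply: hcut; rewrite ltnS leqnn.
- by apply: IH => // t k /andP[t0 tl]; apply: hcut; rewrite t0 leqW.
Qed.

End LevelSets.

End TruncatedWalk.

(** * A time-bounded program logic *)

Section ProgramLogic.
Variables (R : realType) (n : nat) (G : wgraph n) (ok : pred answer).

(** Success with probability exactly 1 can be demanded because the algorithm is deterministic. *)
Definition succeeds (T : nat) (c : config R) := halt_prob G ok T c = 1.

(* [k] run from [s] takes at most [w] time units, and then either has halted
   with an answer in [ok], or ends in a state satisfying [Q]. *)
Definition wp (k : cmd) (s : state R) (w : nat) (Q : state R -> Prop) : Prop :=
  forall ks T,
    (forall s' T', Q s' -> (T <= T')%N -> succeeds T' (Running ks s')) ->
    forall T0, (w + T <= T0)%N -> succeeds T0 (Running (k :: ks) s).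

Lemma succeeds_step c c' T :
  step G c = [:: (1, c')] -> succeeds T c' -> succeeds T.+1 c.
Proof. by rewrite /succeeds /= => -> h; rewrite big_seq1 /= mul1r. Qed.

Lemma succeeds_halted a T : ok a -> succeeds T (Halted R a).
Proof.
move=> oka; elim: T => [|T IH]; first by rewrite /succeeds /= oka.
exact: succeeds_step IH.
Qed.

Lemma wp_weaken k s w w' (Q Q' : state R -> Prop) :
  wp k s w Q -> (w <= w')%N -> (forall s', Q s' -> Q' s') -> wp k s w' Q'.
Proof.
move=> h ww QQ ks T H T0 wT; apply: (h ks T) => [s' T' /QQ|]; first exact: H.
by apply: leq_trans wT; rewrite leq_add2r.
Qed.

Ltac one_step := move=> ks T H [|T0] hT; [lia|]; apply: succeeds_step => //.

Lemma wp_skip s w (Q : state R -> Prop) : (0 < w)%N -> Q s -> wp Skip s w Q.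
Proof. by move=> w0 q; one_step; apply: H => //; lia. Qed.

Lemma wp_nstore a e s w (Q : state R -> Prop) : (0 < w)%N ->
  Q (set_nmem s (neval G s a) (neval G s e)) -> wp (NStore a e) s w Q.
Proof. by move=> w0 q; one_step; apply: H => //; lia. Qed.

Lemma wp_rstore a e s w (Q : state R -> Prop) : (0 < w)%N ->
  Q (set_rmem s (neval G s a) (reval G s e)) -> wp (RStore a e) s w Q.
Proof. by move=> w0 q; one_step; apply: H => //; lia. Qed.

Lemma wp_emit v s w (Q : state R -> Prop) : (0 < w)%N ->
  Q (State (nmem s) (rmem s) (rcons (emitted s) (neval G s v))) ->
  wp (Emit v) s w Q.
Proof. by move=> w0 q; one_step; apply: H => //; lia. Qed.

Lemma wp_seq k1 k2 s w w1 (Q : state R -> Prop) : (w1 < w)%N ->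
  wp k1 s w1 (fun s' => wp k2 s' (w - w1.+1) Q) -> wp (Seq k1 k2) s w Q.
Proof.
move=> w0 h; one_step; apply: (h _ (w - w1.+1 + T)%N) => [s' T' h2 hT'|];
    last lia.
exact: (h2 ks T).
Qed.

Lemma wp_if b k1 k2 s w (Q : state R -> Prop) : (0 < w)%N ->
  (beval G s b -> wp k1 s w.-1 Q) -> (~~ beval G s b -> wp k2 s w.-1 Q) ->
  wp (If b k1 k2) s w Q.
Proof.
move=> w0 h1 h2; one_step; case: ifPn => hb;
    [apply: (h1 hb ks T)|apply: (h2 hb ks T)] => //; lia.
Qed.

(** Halting ends the run, so any [Q] will do as postcondition. *)
Lemma wp_found_cut s w (Q : state R -> Prop) :
  (0 < w)%N -> ok (Cut (emitted s)) -> wp FoundCut s w Q.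
Proof. by move=> w0 h; one_step; exact: succeeds_halted. Qed.

Lemma wp_declare_bound s w (Q : state R -> Prop) :
  (0 < w)%N -> ok Bound -> wp DeclareBound s w Q.
Proof. by move=> w0 h; one_step; exact: succeeds_halted. Qed.

(** Each round pays one unit for its test on top of [f k]; strictness leaves one unit for the final,
    failing test. *)
Lemma wp_while b body (N : nat) (f : nat -> nat) (I : nat -> state R -> Prop)
    s w (Q : state R -> Prop) :
  (\sum_(0 <= k < N) (f k).+1 < w)%N ->
  (forall k s', I k s' -> beval G s' b ->
     (k < N)%N /\ wp body s' (f k) (I k.+1)) ->
  (forall k s', I k s' -> ~~ beval G s' b -> Q s') ->
  I 0%N s -> wp (While b body) s w Q.
Proof.
move=> hw hI hQ.
suff H d : forall k s, (N - k <= d)%N -> I k s ->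
    wp (While b body) s (\sum_(k <= j < N) (f j).+1).+1 Q.
  by move=> I0; apply: wp_weaken (H N 0%N s _ I0) _ _ => //; rewrite subn0.
elim: d => [|d IH] k s' hk Ik; one_step.
  case: ifPn => hb; first by have [] := hI _ _ Ik hb; lia.
  by apply: H; [exact: (hQ _ _ Ik hb)|lia].
case: ifPn => hb; last by apply: H; [exact: (hQ _ _ Ik hb)|lia].
have [kN hbody] := hI _ _ Ik hb.
move: hT; rewrite big_ltn // => hT.
apply: (hbody _ ((\sum_(k.+1 <= j < N) (f j).+1).+1 + T)%N); last by lia.
move=> s2 T2 I2 hT2; apply: (IH k.+1 s2 _ I2 ks T) => //; lia.
Qed.

Definition ng c := NLoad (NCst c).
Definition nset c e := NStore (NCst c) e.
Definition For c bound body :=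
  While (BNLt (ng c) bound) (Seq body (nset c (NAdd (ng c) (NCst 1)))).

(** The 3 units per round are the loop test, the sequencing and the increment of the counter. *)
Lemma wp_for c bound body (N : nat) (f : nat -> nat)
    (I : nat -> state R -> Prop) s w (Q : state R -> Prop) :
  (\sum_(0 <= k < N) (f k + 3) < w)%N ->
  (forall k s', I k s' -> nmem s' c = k /\ neval G s' bound = N) ->
  (forall k s', (k < N)%N -> I k s' ->
     wp body s' (f k) (fun s2 => nmem s2 c = k /\ I k.+1 (set_nmem s2 c k.+1)))
         ->
  (forall s', I N s' -> Q s') ->
  I 0%N s -> wp (For c bound body) s w Q.
Proof.
move=> hw hc hbody hQ I0.
apply: (wp_while (N := N) (f := fun k => (f k + 2)%N)
          (I := fun k s' => (k <= N)%N /\ I k s')) => //.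
- by apply: leq_ltn_trans hw; apply: leq_sum => k _; lia.
- move=> k s' [kN Ik] /=; have [-> ->] := hc _ _ Ik => kN'; split=> //.
  apply: (wp_seq (w1 := f k)); first lia.
  apply: wp_weaken (hbody _ _ kN' Ik) _ _ => // s2 [hk I2].
  apply: wp_nstore; first lia.
  by rewrite /= hk addn1.
- move=> k s' [kN Ik] /=; have [-> ->] := hc _ _ Ik => kN'; apply: hQ.
  by have -> : N = k by lia.
Qed.

End ProgramLogic.

(** * The program *)

Local Notation "k1 ;; k2" := (Seq k1 k2) (at level 60, right associativity).

Definition rg c := RLoad (NCst c).
Definition rset c e := RStore (NCst c) e.

(* Integer cells: 0 n, 3 l, 4 time, 5 base address of the current distribution,
   6 and 7 numbers of vertices in the current and next lists, 8 and 10 loop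
   counters, 9 and 11 vertices, 12 volume, 13 cut weight.  Real cells: 0 alpha,
   1 phi, 2 truncation threshold, 3 level threshold, 4 moved mass.  At time [t]
   the list of the vertices of positive mass starts at [16 + t * n] in the
   integer memory, and the masses are at [16 + t * n + v] in the real one. *)
Definition cell_val v := RLoad (NAdd (ng 5) v).
Definition ldeg_mul v th := RMul (RNat (NAdd (NDeg v) (NDeg v))) th.
Definition active th := BNot (BRLt (cell_val (ng 9)) (ldeg_mul (ng 9) th)).
Definition load_vertex := nset 9 (NLoad (NAdd (ng 5) (ng 8))).

(** A vertex outside the list has mass cell 0, so comparing cells decides whether a neighbour is in
    the level set, without searching the list. *)
Definition count_vertex :=
  nset 12 (NAdd (ng 12) (NAdd (NDeg (ng 9)) (NDeg (ng 9)))) ;;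
  nset 10 (NCst 0) ;;
  For 10 (NNumNbr (ng 9))
    (nset 11 (NNbr (ng 9) (ng 10)) ;;
     If (BRLt (cell_val (ng 11)) (ldeg_mul (ng 11) (rg 3)))
       (nset 13 (NAdd (ng 13) (NWt (ng 9) (ng 11)))) Skip).

Definition count_level :=
  nset 12 (NCst 0) ;; nset 13 (NCst 0) ;; nset 8 (NCst 0) ;;
  For 8 (ng 6) (load_vertex ;; If (active (rg 3)) count_vertex Skip).

Definition emit_level :=
  nset 8 (NCst 0) ;;
  For 8 (ng 6) (load_vertex ;; If (active (rg 3)) (Emit (ng 9)) Skip).

(** The conductance test uses the volume of the level set alone; [level_cut_correct] shows that this
    is the smaller side. *)
Definition test_level :=
  count_level ;;
  If (BRLt (RNat (ng 13)) (RMul (rg 1) (RNat (ng 12))))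
    (emit_level ;; FoundCut) Skip.

Definition test_levels :=
  rset 3 (rg 2) ;;
  While (BRLt (rg 3) (RNat (NCst 1)))
    (test_level ;; rset 3 (RAdd (rg 3) (RDiv (rg 3) (RNat (ng 3))))).

Definition next_addr v := NAdd (NAdd (ng 5) (ng 0)) v.

(** A cell of the next block that is still 0 marks a vertex not yet listed; as every added mass is
    positive, each vertex is listed once. *)
Definition add_mass :=
  If (BRLt (RNat (NCst 0)) (RLoad (next_addr (ng 11)))) Skip
    (NStore (next_addr (ng 7)) (ng 11) ;; nset 7 (NAdd (ng 7) (NCst 1))) ;;
  RStore (next_addr (ng 11)) (RAdd (RLoad (next_addr (ng 11))) (rg 4)).

Definition spread_vertex :=
  nset 11 (ng 9) ;;
  rset 4 (RDiv (cell_val (ng 9)) (RNat (NCst 2))) ;;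
  add_mass ;;
  nset 10 (NCst 0) ;;
  For 10 (NNumNbr (ng 9))
    (nset 11 (NNbr (ng 9) (ng 10)) ;;
     rset 4 (RDiv (RMul (cell_val (ng 9)) (RNat (NWt (ng 9) (ng 11))))
                  (RNat (NAdd (NDeg (ng 9)) (NDeg (ng 9))))) ;;
     add_mass).

Definition spread :=
  nset 7 (NCst 0) ;; nset 8 (NCst 0) ;;
  For 8 (ng 6) (load_vertex ;; If (active (rg 2)) spread_vertex Skip).

(** Each time uses a new block of mass cells, still 0 from the initial state, so that no step pays
    for clearing memory. *)
Definition cut_or_bound :=
  nset 5 (NCst 16) ;; nset 6 (NCst 1) ;;
  rset 2 (RDiv (rg 0) (RNat (ng 3))) ;;
  NStore (NCst 16) (ng 2) ;;
  RStore (NAdd (NCst 16) (ng 2)) (RNat (NCst 1)) ;;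
  For 4 (ng 3)
    (spread ;; nset 5 (NAdd (ng 5) (ng 0)) ;; nset 6 (ng 7) ;; test_levels) ;;
  DeclareBound.

(** * Correctness and running time of the program *)

Lemma big_take_nth (T I : Type) (idx : T) (op : Monoid.law idx) (x0 : I)
    (s : seq I) (P : pred I) (F : I -> T) k : (k < size s)%N ->
  \big[op/idx]_(x <- take k.+1 s | P x) F x =
  op (\big[op/idx]_(x <- take k s | P x) F x)
     (if P (nth x0 s k) then F (nth x0 s k) else idx).
Proof.
move=> ks; rewrite (take_nth x0 ks) -cats1 big_cat /= big_cons big_nil.
by case: ifP; rewrite ?Monoid.mulm1.
Qed.

Lemma big_seq_set (T : Type) (I : finType) (idx : T) (op : Monoid.com_law idx)
    (s : seq I) (A : {set I}) (F : I -> T) : uniq s -> {subset A <= s} ->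
  \big[op/idx]_(x <- s | x \in A) F x = \big[op/idx]_(x in A) F x.
Proof.
move=> us As; rewrite -big_filter big_uniq ?filter_uniq //.
by apply: eq_bigl => x; rewrite mem_filter andbC;
    case: (boolP (x \in A)) => [/As|_]; rewrite ?andbT ?andbF.
Qed.

Section Correctness.
Variables (R : realType) (n : nat) (G : wgraph n).
Hypothesis deg_gt0 : forall j : 'I_n, (0 < deg G j)%N.
Variables (i : 'I_n) (l : nat) (alpha phi : R).

Let e := alpha / l%:R.
Hypothesis e_gt0 : 0 < e.

Local Notation ok := (correct G i l alpha phi).
Local Notation twalk := (twalk G i e).
Local Notation level := (level G i e).
Local Notation ldeg := (ldeg R G).
Local Notation wp := (wp G ok).

Lemma at_vertexE (j : 'I_n) f : at_vertex (val j) f = f j.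
Proof. by rewrite /at_vertex valK. Qed.

(** The loop counter [c] and the time [t] of the stored distribution are separate, because the block
    advances before the counter does. *)
Record at_time (c t : nat) (L : seq 'I_n) (s : state R) : Prop := AtTime {
  at_n : nmem s 0 = n;
  at_l : nmem s 3 = l;
  at_t : nmem s 4 = c;
  at_base : nmem s 5 = (16 + t * n)%N;
  at_size : nmem s 6 = size L;
  at_list : forall k, (k < size L)%N ->
    nmem s (16 + t * n + k) = val (nth i L k);
  at_val : forall v : 'I_n, rmem s (16 + t * n + v) = twalk t v;
  at_phi : rmem s 1 = phi;
  at_eps : rmem s 2 = e }.

Definition support (t : nat) (L : seq 'I_n) :=
  uniq L /\ forall v, (v \in L) = (0 < twalk t v).

Lemma support_size t L : support t L -> (size L <= n)%N.
Proof.
by move=> [uL _]; rewrite -(card_uniqP uL) (leq_trans (max_card _)) // card_ord.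
Qed.

Lemma level_support t L th : support t L -> 0 < th ->
  {subset level t th <= L}.
Proof.
move=> [_ h] th0 v; rewrite inE h; apply: lt_le_trans.
by rewrite mulr_gt0 // ldeg_gt0.
Qed.

(** The admissible addresses are scratch cells and those beyond the current block, whose list has at
    most [n] entries. *)
Lemma at_time_nset c t L s a x : support t L ->
  (6 < a < 16)%N || (16 + t * n + n <= a)%N ->
  at_time c t L s -> at_time c t L (set_nmem s a x).
Proof.
move=> /support_size hL ha [h0 h3 h4 h5 h6 hl hv hp he].
split=> //=; try by rewrite /upd ifN //; apply/eqP; move: ha; lia.
by move=> k kL; rewrite /upd ifN ?hl //; apply/eqP; move: ha; lia.
Qed.

Lemma at_time_rset c t L s a x :
  (2 < a < 16)%N || (16 + t * n + n <= a)%N ->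
  at_time c t L s -> at_time c t L (set_rmem s a x).
Proof.
move=> ha [h0 h3 h4 h5 h6 hl hv hp he].
split=> //=; try by rewrite /upd ifN //; apply/eqP; move: ha; lia.
by move=> v; rewrite /upd ifN ?hv //; apply/eqP; have := ltn_ord v; move: ha;
    lia.
Qed.

Lemma at_time_emit c t L s v :
  at_time c t L s -> at_time c t L (State (nmem s) (rmem s) v).
Proof. by case=> *; split. Qed.

Lemma neval_load c t L s k : at_time c t L s -> nmem s 8 = k ->
  (k < size L)%N ->
  neval G s (NLoad (NAdd (ng 5) (ng 8))) = val (nth i L k).
Proof. by move=> h /= -> kL; rewrite (at_base h) (at_list h). Qed.

Lemma reval_cell c t L s a (u : 'I_n) : at_time c t L s -> nmem s a = val u ->
  reval G s (cell_val (ng a)) = twalk t u.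
Proof. by move=> h /= ->; rewrite (at_base h) (at_val h). Qed.

Lemma reval_ldeg_mul s a th (u : 'I_n) : nmem s a = val u ->
  reval G s (ldeg_mul (ng a) th) = ldeg u * reval G s th.
Proof. by move=> /= ->; rewrite at_vertexE ldegE natrD; congr (_ * _);
    ring. Qed.

Lemma beval_active c t L s th (u : 'I_n) : at_time c t L s ->
  nmem s 9 = val u ->
  beval G s (active th) = (u \in level t (reval G s th)).
Proof.
move=> h hu; have h1 := reval_cell h hu; have h2 := reval_ldeg_mul th hu.
by rewrite /active; cbn [beval]; rewrite h1 h2 -leNgt inE.
Qed.

Definition nnbr (u : 'I_n) := size (nbrs G u).

Lemma nth_nbrs (u : 'I_n) k : (k < nnbr u)%N ->
  nth 0%N (map val (nbrs G u)) k = val (nth i (nbrs G u) k).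
Proof. by move=> ku; rewrite (nth_map i). Qed.

Lemma sum_nbrs (u : 'I_n) (P : pred 'I_n) :
  (\sum_(v <- nbrs G u | P v) wt G u v = \sum_(v | P v) wt G u v)%N.
Proof.
rewrite big_filter_cond big_enum_cond /= [RHS](bigID (fun v => 0 < wt G u v)%N)
    /=.
rewrite [X in (_ + X)%N]big1 ?addn0; first by apply: eq_bigl => v;
    rewrite andbC.
by move=> v /andP[_]; rewrite -eqn0Ngt => /eqP.
Qed.

Lemma count_vertex_spec c t L s u : support t L -> at_time c t L s ->
  nmem s 9 = val u ->
  wp count_vertex s (7 * nnbr u + 6)
    (fun s' => [/\ at_time c t L s', rmem s' = rmem s, emitted s' = emitted s,
       nmem s' 8 = nmem s 8 &
       nmem s' 12 = (nmem s 12 + 2 * deg G u)%N /\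
       nmem s' 13 = (nmem s 13 +
          \sum_(v | v \notin level t (rmem s 3)) wt G u v)%N]).
Proof.
move=> sup at_s su; rewrite /count_vertex.
apply: (wp_seq (w1 := 1)); first lia.
apply: wp_nstore => //.
apply: (wp_seq (w1 := 1)); first lia.
apply: wp_nstore => //=.
rewrite su at_vertexE.
set s1 := set_nmem _ _ _.
have at1 : at_time c t L s1 by do 2 apply: at_time_nset => //.
pose I k s' := [/\ at_time c t L s', rmem s' = rmem s, emitted s' = emitted s,
   nmem s' 8 = nmem s 8 & [/\ nmem s' 9 = val u, nmem s' 10 = k,
       nmem s' 12 = (nmem s 12 + 2 * deg G u)%N &
       nmem s' 13 = (nmem s 13 +
          \sum_(v <- take k (nbrs G u) | v \notin level t (rmem s 3)) wt G u
              v)%N]].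
apply: (wp_for (N := nnbr u) (f := fun=> 4%N) (I := I)).
- by rewrite sum_nat_const_nat; lia.
- by move=> k s' [_ _ _ _ [h9 h10 _ _]]; rewrite /= h9 at_vertexE.
- move=> k s' ku [at' hr he h8 [h9 h10 h12 h13]].
  apply: (wp_seq (w1 := 1)) => //.
  apply: wp_nstore => //=.
  rewrite h9 h10 at_vertexE nth_nbrs //.
  set v := nth i _ k; set s2 := set_nmem _ _ _.
  have at2 : at_time c t L s2 by apply: at_time_nset.
  have hv : nmem s2 11 = val v by [].
  have tak := big_take_nth addn i (fun v => v \notin level t (rmem s 3))
     (fun v => wt G u v) ku.
  apply: wp_if => //; cbn [beval];
    rewrite (reval_cell at2 hv) (reval_ldeg_mul _ hv) => hlt.
    apply: wp_nstore => //=; split=> //.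
    have vl : v \notin level t (rmem s 3).
      by rewrite inE -ltNge -hr.
    split=> //; first by do 2 apply: at_time_nset => //.
    split=> //; rewrite /upd /= h9 !at_vertexE h13 tak -/v vl.
    by rewrite addnA.
  apply: wp_skip => //; split=> //.
  have vl : v \in level t (rmem s 3).
    by rewrite inE leNgt -hr.
  split=> //; first by apply: at_time_nset => //.
  by split=> //; apply: (etrans h13); rewrite tak -/v vl /= addn0.
- move=> s' [at' hr he h8 [h9 h10 h12 h13]]; split=> //; split=> //.
  by rewrite h13 take_oversize // sum_nbrs.
- split=> //; split=> //; rewrite /s1 /upd /= ?take0 ?big_nil ?addn0 //.
  by congr (_ + _)%N; lia.
Qed.

(** Common rule for the loops that count, emit or spread a level set: 7 units per list entry for the
    scan, plus [f u] for each vertex of the level set. *)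
Lemma wp_active_loop c t L a th k1 (f : 'I_n -> nat)
    (I : nat -> state R -> Prop) s w (Q : state R -> Prop) :
  support t L -> 0 < th ->
  (7 * size L + \sum_(u in level t th) f u < w)%N ->
  (forall k s', I k s' -> [/\ at_time c t L s', nmem s' 8 = k & rmem s' a =
      th]) ->
  (forall k s', (k < size L)%N -> I k s' -> nth i L k \in level t th ->
     wp k1 (set_nmem s' 9 (val (nth i L k))) (f (nth i L k))
       (fun s2 => nmem s2 8 = k /\ I k.+1 (set_nmem s2 8 k.+1))) ->
  (forall k s', (k < size L)%N -> I k s' -> nth i L k \notin level t th ->
     I k.+1 (set_nmem (set_nmem s' 9 (val (nth i L k))) 8 k.+1)) ->
  (forall s', I (size L) s' -> Q s') ->
  I 0%N s ->
  wp (For 8 (ng 6) (load_vertex ;; If (active (rg a)) k1 Skip)) s w Q.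
Proof.
move=> sup th0 hw hI hin hout hQ I0.
pose f' u := (if u \in level t th then (f u).+4 else 4)%N.
apply: (wp_for (N := size L) (f := fun k => f' (nth i L k)) (I := I)) => //.
- rewrite -(big_nth i xpredT (fun u => f' u + 3)%N).
  apply: leq_ltn_trans hw.
  rewrite -(big_seq_set addn _ sup.1 (level_support sup th0)).
  rewrite -sum1_size big_distrr /= [X in (_ <= _ + X)%N]big_mkcond -big_split
      /=.
  by apply: leq_sum => u _; rewrite /f'; case: ifP => _; lia.
- by move=> k s' /hI[h h8 _]; rewrite /= h8 (at_size h).
- move=> k s' kL Ik; have [h h8 ha] := hI _ _ Ik.
  apply: (wp_seq (w1 := 1)); first by rewrite /f'; case: ifP.
  apply: wp_nstore => //; rewrite (neval_load h h8 kL) /=.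
  set u := nth i L k.
  have h9 : at_time c t L (set_nmem s' 9 (val u)) by apply: at_time_nset.
  apply: wp_if; rewrite ?(beval_active _ h9 (u := u)) //=;
      first by rewrite /f'; case: ifP.
    by rewrite ha => ul; apply: wp_weaken (hin _ _ kL Ik ul) _ _ => //;
        rewrite /f' ul.
  rewrite ha => ul; apply: wp_skip; first by rewrite /f' (negbTE ul).
  by split=> //; exact: hout.
Qed.

Lemma count_level_spec c t L th s w : support t L -> at_time c t L s ->
  0 < th -> rmem s 3 = th ->
  (7 * size L + \sum_(u in level t th) (7 * nnbr u + 6) + 6 < w)%N ->
  wp count_level s w
    (fun s' => [/\ at_time c t L s', rmem s' = rmem s, emitted s' = emitted s,
       nmem s' 12 = vol' G (level t th) & nmem s' 13 = cut_weight G (level t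
           th)]).
Proof.
move=> sup at_s th0 hth hw; rewrite /count_level.
do 3 (apply: (wp_seq (w1 := 1)); [lia|]; apply: wp_nstore => //).
rewrite /=; set s1 := set_nmem _ 8 _.
have at1 : at_time c t L s1 by do 3 apply: at_time_nset => //.
pose I k s' := [/\ at_time c t L s', rmem s' = rmem s, emitted s' = emitted s,
   nmem s' 8 = k & nmem s' 12 = (\sum_(u <- take k L | u \in level t th) 2 *
       deg G u)%N /\
   nmem s' 13 = (\sum_(u <- take k L | u \in level t th)
     \sum_(v | v \notin level t th) wt G u v)%N].
apply: (wp_active_loop (f := fun u => (7 * nnbr u + 6)%N) (I := I)
          sup th0 (k1 := count_vertex) (c := c)).
- lia.
- by move=> k s' [? -> _ ? _].
- move=> k s' kL [at' hr he h8 [h12 h13]] ul; set u := nth i L k.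
  have at9 : at_time c t L (set_nmem s' 9 (val u)) by apply: at_time_nset.
  apply: wp_weaken (count_vertex_spec sup at9 (erefl _)) (leqnn _) _ => s2 [].
  rewrite /= /upd /= => at2 hr2 he2 h82 [h122 h132].
  rewrite hr hth in h132.
  split; first by rewrite h82.
  split; rewrite ?hr2 ?he2 //=; first exact: at_time_nset.
  rewrite /upd /= h122 h132 h12 h13.
  by rewrite !(big_take_nth addn i _ _ kL) /= ul.
- move=> k s' kL [at' hr he h8 [h12 h13]] ul.
  split=> //; first by do 2 apply: at_time_nset => //.
  rewrite /= /upd /= h12 h13 !(big_take_nth addn i _ _ kL) /=.
  by rewrite (negbTE ul) !addn0.
- move=> s' [at' hr he h8 []]; rewrite take_size.
  rewrite !(big_seq_set addn _ sup.1 (level_support sup th0)) => h12 h13.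
  split=> //; first by rewrite h12 /vol' big_distrr.
  rewrite h13; apply: eq_bigr => u _; apply: eq_bigl => v; by rewrite in_setC.
- by split=> //; rewrite take0 !big_nil.
Qed.

Lemma emit_level_spec c t L th s w : support t L -> at_time c t L s ->
  0 < th -> rmem s 3 = th -> emitted s = [::] ->
  (7 * size L + #|level t th| + 2 < w)%N ->
  wp emit_level s w
    (fun s' => emitted s' = [seq val u | u <- L & u \in level t th]).
Proof.
move=> sup at_s th0 hth he hw; rewrite /emit_level.
apply: (wp_seq (w1 := 1)); first lia.
apply: wp_nstore => //=; set s1 := set_nmem _ 8 _.
pose I k s' := [/\ at_time c t L s', rmem s' = rmem s, nmem s' 8 = k &
  emitted s' = [seq val u | u <- take k L & u \in level t th]].
apply: (wp_active_loop (f := fun=> 1%N) (I := I)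
          sup th0 (k1 := Emit (ng 9)) (c := c)).
- by rewrite sum1_card; lia.
- by move=> k s' [? -> ? _].
- move=> k s' kL [at' hr h8 hem] ul; apply: wp_emit => //=; split=> //.
  split=> //=; first by apply: at_time_nset => //;
      apply: (@at_time_emit _ _ _ (set_nmem s' 9 _)); exact: at_time_nset.
  by rewrite /upd /= hem (take_nth i kL) filter_rcons ul map_rcons.
- move=> k s' kL [at' hr h8 hem] ul; split=> //=;
    first by do 2 apply: at_time_nset => //.
  by rewrite hem (take_nth i kL) filter_rcons (negbTE ul).
- by move=> s' [_ _ _]; rewrite take_size.
- by split=> //; [exact: at_time_nset|rewrite take0].
Qed.

Hypothesis vol_small : 1 <= e * (total_deg G)%:R.

(** By [vol_small] the level set has volume at most [1 / e <= total_deg G], half of the whole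
    [vol']. Hence it is proper and its own volume is the minimum in the conductance; the strict
    inequality excludes volume 0. *)
Lemma level_cut_correct t L th : support t L -> e <= th ->
  (cut_weight G (level t th))%:R < phi * (vol' G (level t th))%:R ->
  ok (Cut [seq val u | u <- L & u \in level t th]).
Proof.
move=> sup eth hcut /=; set vs := map _ _; set S := level t th in hcut vs *.
have th0 : 0 < th by exact: lt_le_trans eth.
have -> : finset (fun v : 'I_n => val v \in vs) = S.
  apply/setP => v; rewrite inE mem_map; last exact: val_inj.
  by rewrite mem_filter andb_idr //; exact: (level_support sup th0).
have volS : (vol' G S <= total_deg G)%N.
  rewrite -(ler_nat R) -(ler_pM2l e_gt0) (le_trans _ vol_small) //.
  apply: le_trans (vol'_level_le deg_gt0 i e t (ltW th0)).
  by rewrite ler_wpM2r.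
have volT : (vol' G S + vol' G (~: S) = 2 * total_deg G)%N.
  rewrite /vol' -mulnDr /total_deg [in RHS](bigID (mem S)) /=.
  by congr (2 * (_ + _))%N; apply: eq_bigl => v; rewrite inE.
have vol0 : vol' G S != 0%N.
  by apply/eqP => v0; move: hcut; rewrite v0 mulr0 ltNge ler0n.
apply/and4P; split.
- by apply/allP => x /mapP[u _ ->]; exact: ltn_ord.
- by rewrite -(vol'_eq0 deg_gt0).
- apply/eqP => ST; move: volT volS vol0; rewrite ST setCT.
  have -> : vol' G finset.set0 = 0%N by apply/eqP; rewrite vol'_eq0.
  by move=> h1 h2 h3; lia.
- rewrite /conductance (minn_idPl _); last by move: volT volS; lia.
  by rewrite ltr_pdivrMr // ltr0n lt0n.
Qed.

(** Measures a scan of the level set at threshold [e], which contains those at all higher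
    thresholds. *)
Definition work t := (\sum_(u in level t e) (nnbr u).+1)%N.

Definition passes t th :=
  phi * (vol' G (level t th))%:R <= (cut_weight G (level t th))%:R.

Lemma sum_level_le t th F : e <= th ->
  (\sum_(u in level t th) F u <= \sum_(u in level t e) F u)%N.
Proof.
move=> eth; rewrite big_mkcond [leqRHS]big_mkcond; apply: leq_sum => u _.
rewrite !inE; case: ifP => // h; rewrite ifT // (le_trans _ h) // ler_wpM2l //.
by rewrite ltW // ldeg_gt0.
Qed.

Lemma test_level_spec c t L th s D : support t L -> at_time c t L s ->
  e <= th -> rmem s 3 = th -> emitted s = [::] ->
  (0 < D)%N -> (size L <= D)%N -> (work t <= D)%N ->
  wp test_level s (40 * D)
    (fun s' => [/\ at_time c t L s', rmem s' = rmem s, emitted s' = [::] &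
       passes t th]).
Proof.
move=> sup at_s eth hth he D0 LD wD.
have th0 : 0 < th by exact: lt_le_trans eth.
have w1 : (\sum_(u in level t th) (7 * nnbr u + 6) <= 7 * D)%N.
  apply: leq_trans (sum_level_le _ _ eth) _.
  apply: leq_trans (_ : 7 * work t <= _)%N; last by rewrite leq_mul2l.
  by rewrite /work big_distrr /=; apply: leq_sum => u _; lia.
have w2 : (#|level t th| <= D)%N.
  rewrite -sum1_card; apply: leq_trans (sum_level_le _ _ eth) _.
  by apply: leq_trans wD; apply: leq_sum.
apply: (wp_seq (w1 := 21 * D)); first lia.
apply: wp_weaken (count_level_spec sup at_s th0 hth (leqnn _)) _ _; first lia.
move=> s' [at' hr' he' h12 h13].
apply: wp_if; first lia.
  cbn [beval reval neval]; rewrite /= h13 h12 (at_phi at') => hcut.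
  apply: (wp_seq (w1 := (7 * size L + #|level t th| + 2).+1)); first lia.
  apply: wp_weaken (emit_level_spec sup at' th0 _ _ (leqnn _)) (leqnn _) _.
  - by rewrite hr'.
  - by rewrite he'.
  move=> s2 he2; apply: wp_found_cut; first lia.
  by rewrite he2; exact: level_cut_correct.
rewrite /= h13 h12 (at_phi at') -leNgt => hcut.
by apply: wp_skip; [lia|split=> //; rewrite he'].
Qed.

Let g : R := 1 + l%:R^-1.

Lemma test_levels_spec c t L s D N : support t L -> at_time c t L s ->
  emitted s = [::] ->
  (0 < D)%N -> (size L <= D)%N -> (work t <= D)%N -> 1 <= e * g ^+ N ->
  wp test_levels s ((43 * N + 4) * D)
    (fun s' => [/\ at_time c t L s', forall a, (16 <= a)%N -> rmem s' a = rmem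
        s a,
       emitted s' = [::] & forall k, e * g ^+ k < 1 -> passes t (e * g ^+ k)]).
Proof.
move=> sup at_s he D0 LD wD hN.
have g1 : 1 <= g by rewrite /g lerDl invr_ge0.
apply: (wp_seq (w1 := 1)); first lia.
apply: wp_rstore => //; rewrite /= (at_eps at_s).
pose I k s' := [/\ at_time c t L s', forall a, (16 <= a)%N -> rmem s' a = rmem
    s a,
  emitted s' = [::], rmem s' 3 = e * g ^+ k &
  forall j, (j < k)%N -> passes t (e * g ^+ j)].
apply: (wp_while (N := N) (f := fun=> (40 * D + 2)%N) (I := I)).
- by rewrite sum_nat_const_nat; nia.
- move=> k s' [at' hr' he' h3 hp]; rewrite /= h3 => lt1; split.
    (* Thresholds increase and [hN] puts the [N]-th at 1 or more, so a round starts only for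
       [k < N]. *)
    rewrite ltnNge; apply/negP => Nk; move: lt1; rewrite ltNge (le_trans hN) //.
    by rewrite ler_wpM2l ?(ltW e_gt0) // ler_weXn2l.
  apply: (wp_seq (w1 := 40 * D)); first lia.
  have ek : e <= e * g ^+ k by rewrite ler_peMr ?(ltW e_gt0) // exprn_ege1.
  apply: wp_weaken (test_level_spec sup at' ek h3 he' D0 LD wD) (leqnn _) _.
  move=> s2 [at2 hr2 he2 pass]; apply: wp_rstore; first lia.
  rewrite /=; split=> //.
  + exact: at_time_rset.
  + by move=> a ha; rewrite /= /upd ifN ?hr2 ?hr' //; apply/eqP; lia.
  + by rewrite /= /upd /= hr2 h3 (at_l at2) exprSr /g; lra.
  + by move=> j; rewrite ltnS leq_eqVlt => /orP[/eqP->|/hp].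
- move=> k s' [at' hr' he' h3 hp]; rewrite /= h3 -leNgt => ge1; split=> // j j1.
  apply: hp; rewrite ltnNge; apply/negP => kj; move: j1.
  rewrite ltNge (le_trans ge1) // ler_wpM2l ?(ltW e_gt0) // ler_weXn2l //.
- split=> //=; first exact: at_time_rset.
  + by move=> a ha; rewrite /= /upd ifN //; apply/eqP; lia.
  + by rewrite /upd /= expr0 mulr1.
Qed.

(** [rho] is the distribution accumulated so far; [next_fresh] keeps the zero cells from which the
    following step starts. *)
Record next_list (t : nat) (rho : 'I_n -> R) (L : seq 'I_n) (s : state R) :
    Prop :=
  NextList {
  next_size : nmem s 7 = size L;
  next_uniq : uniq L;
  next_mem : forall v, (v \in L) = (0 < rho v);
  next_ge0 : forall v, 0 <= rho v;
  next_nth : forall k, (k < size L)%N ->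
    nmem s (16 + t * n + n + k) = val (nth i L k);
  next_val : forall v : 'I_n, rmem s (16 + t * n + n + v) = rho v;
  next_fresh : forall a, (16 + t * n + n + n <= a)%N -> rmem s a = 0 }.

Lemma next_list_ext t rho rho' L s : (forall v, rho v = rho' v) ->
  next_list t rho L s -> next_list t rho' L s.
Proof.
move=> h [h7 uL hm h0 hl hv hf]; split=> // v.
- by rewrite hm h.
- by rewrite -h.
- by rewrite hv h.
Qed.

Lemma next_list_nset t rho L s a x : (7 < a < 16)%N ->
  next_list t rho L s -> next_list t rho L (set_nmem s a x).
Proof.
move=> ha [h7 uL hm h0 hl hv hf]; split=> //=.
  by rewrite /upd ifN //; apply/eqP; lia.
by move=> k kL; rewrite /upd ifN ?hl //; apply/eqP; lia.
Qed.

Lemma next_list_rset t rho L s a x : (a < 16)%N ->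
  next_list t rho L s -> next_list t rho L (set_rmem s a x).
Proof.
move=> ha [h7 uL hm h0 hl hv hf]; split=> //= [v|b hb].
  by rewrite /upd ifN ?hv //; apply/eqP; lia.
by rewrite /upd ifN ?hf //; apply/eqP; lia.
Qed.

Lemma add_mass_spec c t L rho L' s v : support t L -> at_time c t L s ->
  next_list t rho L' s -> nmem s 11 = val v -> 0 < rmem s 4 ->
  wp add_mass s 6
    (fun s' => [/\ at_time c t L s',
       exists L2, next_list t (fun u => rho u + (u == v)%:R * rmem s 4) L2 s',
       forall a, (7 < a < 16)%N -> nmem s' a = nmem s a &
       emitted s' = emitted s]).
Proof.
move=> sup at_s nx hv x0; set x := rmem s 4 in x0 *.
have addr s' y : at_time c t L s' ->
    (nmem s' 5 + nmem s' 0 + y = 16 + t * n + n + y)%N.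
  by move=> h; rewrite (at_base h) (at_n h).
have [h7 uL hm h0 hl hval hf] := nx.
(* Both branches end with this store: [L2] is [L'] with [v] added if missing. *)
have store L2 s' : at_time c t L s' -> rmem s' = rmem s -> nmem s' 11 = val v ->
    emitted s' = emitted s -> (forall a, (7 < a < 16)%N -> nmem s' a = nmem s
        a) ->
    nmem s' 7 = size L2 -> uniq L2 -> L2 =i [predU1 v & L'] ->
    (forall k, (k < size L2)%N -> nmem s' (16 + t * n + n + k) = val (nth i L2
        k)) ->
    wp (RStore (next_addr (ng 11)) (RAdd (RLoad (next_addr (ng 11))) (rg 4)))
        s' 1
    (fun s' => [/\ at_time c t L s',
       exists L2, next_list t (fun u => rho u + (u == v)%:R * x) L2 s',
       forall a, (7 < a < 16)%N -> nmem s' a = nmem s a &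
       emitted s' = emitted s]).
  move=> at' hr' hv' he' hs' h7' u2 m2 l2; apply: wp_rstore => //=.
  rewrite (addr _ _ at') hr' hv' hval; split=> //.
    by apply: at_time_rset => //; apply/orP; right; lia.
  exists L2; split=> //=.
  - move=> u; rewrite m2 inE /= hm; have [->|_] := eqVneq u v.
      by rewrite mul1r ltr_wpDl.
    by rewrite mul0r addr0.
  - by move=> u; rewrite addr_ge0 // mulr_ge0 // ltW.
  - move=> u; rewrite /upd hr'; have [->|uv] := eqVneq u v.
      by rewrite eqxx mul1r.
    rewrite ifN ?hval ?mul0r ?addr0 //.
    by apply: contra uv => /eqP h; apply/eqP/val_inj => /=; lia.
  - move=> a ha; rewrite /upd hr' ifN ?hf //; apply/eqP.
    by have := ltn_ord v; lia.
apply: (wp_seq (w1 := 4)) => //; apply: wp_if => //=;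
    rewrite (addr _ _ at_s) hv hval => hpos.
  apply: wp_skip => //; apply: (store L') => //.
  by move=> u; rewrite inE /=; case: eqP => // ->; rewrite hm hpos.
have vL : v \notin L' by rewrite hm.
apply: (wp_seq (w1 := 1)) => //; apply: wp_nstore => //.
apply: wp_nstore => //=.
rewrite (addr _ _ at_s) hv h7.
have -> y : upd (nmem s) (16 + t * n + n + size L') y 7 = size L' by [].
apply: (store (rcons L' v)) => //=.
- apply: at_time_nset => //; apply: at_time_nset => //; apply/orP; right; lia.
- move=> a ha; rewrite /= /upd ifN; last by apply/eqP; lia.
  by rewrite ifN //; apply/eqP; lia.
- by rewrite /upd /= size_rcons addn1.
- by rewrite rcons_uniq vL.
- by move=> u; rewrite mem_rcons !inE.
- move=> k; rewrite size_rcons ltnS => kL; rewrite /upd /= eqn_add2l nth_rcons.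
  by case: ltngtP kL => // kL _; rewrite hl.
Qed.

Local Notation M := (lazy_mx R G).

Lemma sum_nbrs_delta (u v : 'I_n) (F : 'I_n -> R) :
  (wt G u v = 0%N -> F v = 0) ->
  \sum_(x <- nbrs G u) (v == x)%:R * F x = F v.
Proof.
move=> F0; rewrite big_filter big_enum_cond /= (big_mkcond (fun x => _ < _)%N).
rewrite (bigD1 v) //= eqxx mul1r big1 ?addr0 => [|x].
  by case: ifPn => //; rewrite -eqn0Ngt => /eqP/F0.
by rewrite eq_sym => /negbTE->; rewrite mul0r if_same.
Qed.

Lemma spread_vertex_spec c t L rho L' s u : support t L -> at_time c t L s ->
  next_list t rho L' s -> nmem s 9 = val u -> 0 < twalk t u ->
  wp spread_vertex s (14 * nnbr u + 14)
    (fun s' => [/\ at_time c t L s',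
       exists L2, next_list t (fun v => rho v + twalk t u * M u v) L2 s',
       nmem s' 8 = nmem s 8 & emitted s' = emitted s]).
Proof.
move=> sup at_s nx h9 tw0; rewrite /spread_vertex.
apply: (wp_seq (w1 := 1)); first lia.
apply: wp_nstore => //=; rewrite h9.
apply: (wp_seq (w1 := 1)); first lia.
apply: wp_rstore => //; set s1 := set_nmem _ _ _.
have at1 : at_time c t L s1 by exact: at_time_nset.
rewrite /= [X in set_rmem _ _ X](_ : _ = twalk t u / 2); last first.
  by congr (_ / _); exact: (reval_cell (a := 9) at1).
apply: (wp_seq (w1 := 6)); first lia.
apply: wp_weaken (@add_mass_spec c t L rho L' _ u sup _ _ _ _) (leqnn _) _ =>
    //.
- exact: at_time_rset.
- by apply: next_list_rset => //; apply: next_list_nset.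
- by rewrite /= /upd /= divr_gt0.
move=> s2 [at2 [L2 nx2] hs2 he2].
apply: (wp_seq (w1 := 1)); first lia.
apply: wp_nstore => //=.
(* The share of the mass of [u] sent along the edge to [x]; the half kept at [u] has already been
   added. *)
pose F x : R := twalk t u * (wt G u x)%:R / ldeg u.
pose I k s' := [/\ at_time c t L s',
  exists L2, next_list t (fun v => rho v + (v == u)%:R * (twalk t u / 2) +
       \sum_(x <- take k (nbrs G u)) (v == x)%:R * F x) L2 s',
  forall a, a = 8%N \/ a = 9%N -> nmem s' a = nmem s a, nmem s' 10 = k &
      emitted s' = emitted s].
apply: (wp_for (N := nnbr u) (f := fun=> 11%N) (I := I)).
- by rewrite sum_nat_const_nat; lia.
- move=> k s' [_ _ h89 h10 _]; rewrite /= h10 h89 ?h9 ?at_vertexE //; by right.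
- move=> k s' ku [at' [L3 nx3] h89 h10 he'].
  have h9' : nmem s' 9 = val u by rewrite h89 //; right.
  apply: (wp_seq (w1 := 1)) => //.
  apply: wp_nstore => //=; rewrite h9' h10 at_vertexE nth_nbrs //.
  set x := nth i _ k; set s3 := set_nmem _ _ _.
  have at3 : at_time c t L s3 by exact: at_time_nset.
  have wx : (0 < wt G u x)%N.
    by have := mem_nth i ku; rewrite mem_filter => /andP[].
  apply: (wp_seq (w1 := 1)) => //.
  apply: wp_rstore => //.
  rewrite [X in set_rmem _ _ X](_ : _ = F x); last first.
    rewrite /F; have <- := @reval_cell c t L s3 9%N u at3 h9'.
    rewrite /= /upd /= h9' !at_vertexE; congr (_ / _).
    by rewrite ldegE natrD; ring.
  apply: wp_weaken (@add_mass_spec c t L _ L3 _ x sup _ _ _ _) _ _ => //.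
  + exact: at_time_rset.
  + by apply: next_list_rset => //; apply: next_list_nset => //; exact: nx3.
  + by rewrite /= /upd /= divr_gt0 ?ldeg_gt0 ?mulr_gt0 ?ltr0n.
  move=> s4 [at4 [L4 nx4] hs4 he4].
  split; first by rewrite hs4.
  split=> //=.
  + exact: at_time_nset.
  + exists L4; apply: next_list_nset => //; apply: next_list_ext nx4 => v.
    by rewrite (big_take_nth +%R i _ _ ku) /= /upd /= addrA.
  + move=> a ha; rewrite /upd ifN; last by case: ha => ->.
    by rewrite hs4; [rewrite -h89 // /s3 /= /upd ifN //; case: ha => ->|lia].
  + by rewrite he4.
- move=> s' [at' [L3 nx3] h89 h10 he']; split=> //; last by rewrite h89 //;
    left.
  exists L3; apply: next_list_ext nx3 => v.
  rewrite take_size sum_nbrs_delta; last by move=> w0;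
      rewrite /F w0 mulr0 mul0r.
  rewrite mxE /F ldegE [u == v]eq_sym -addrA; congr (_ + _).
  have : (deg G u)%:R != 0 :> R by rewrite pnatr_eq0 -lt0n.
  by move: (v == u)%:R => y d0; field.
- split=> //.
  + exact: at_time_nset.
  + exists L2; apply: next_list_nset => //; apply: next_list_ext nx2 => v.
    by rewrite take0 big_nil addr0 /= /upd.
  + by move=> a [] ->; rewrite /= /upd /= hs2.
Qed.

Lemma spread_spec c t L s D : support t L -> at_time c t L s ->
  (forall a, (16 + t * n + n <= a)%N -> rmem s a = 0) ->
  (0 < D)%N -> (size L <= D)%N -> (work t <= D)%N ->
  wp spread s (28 * D)
    (fun s' => [/\ at_time c t L s',
       exists L', next_list t (twalk t.+1) L' s' & emitted s' = emitted s]).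
Proof.
move=> sup at_s fr D0 LD wD; rewrite /spread.
do 2 (apply: (wp_seq (w1 := 1)); [lia|]; apply: wp_nstore => //).
pose I k s' := [/\ at_time c t L s',
  exists L', next_list t
    (fun v => \sum_(u <- take k L | u \in level t e) twalk t u * M u v) L' s',
  nmem s' 8 = k & emitted s' = emitted s].
apply: (wp_active_loop (f := fun u => (14 * nnbr u + 14)%N) (I := I)
          sup e_gt0 (k1 := spread_vertex) (c := c)).
- rewrite (eq_bigr (fun u => 14 * (nnbr u).+1)%N); last by move=> u _; lia.
  by rewrite -big_distrr /= -/(work t); lia.
- by move=> k s' [at' _ h8 _]; split=> //; exact: at_eps at'.
- move=> k s' kL [at' [L' nx'] h8 he'] ul; set u := nth i L k.
  have tw0 : 0 < twalk t u by rewrite -(sup.2 u) mem_nth.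
  have at9 : at_time c t L (set_nmem s' 9 (val u)) by exact: at_time_nset.
  have nx9 := next_list_nset (a := 9) (val u) isT nx'.
  apply: wp_weaken (spread_vertex_spec sup at9 nx9 (erefl _) tw0) (leqnn _) _.
  move=> s2 [at2 [L2 nx2] h82 he2]; split; first by rewrite h82.
  split=> //=; [exact: at_time_nset| |by rewrite he2].
  exists L2; apply: next_list_nset => //; apply: next_list_ext nx2 => v.
  by rewrite (big_take_nth +%R i _ _ kL) /= ul.
- move=> k s' kL [at' [L' nx'] h8 he'] ul; split=> //.
    by do 2 apply: at_time_nset => //.
  exists L'; do 2 apply: next_list_nset => //.
  apply: next_list_ext nx' => v.
  by rewrite (big_take_nth +%R i _ _ kL) /= (negbTE ul) addr0.
- move=> s' [at' [L' nx'] h8 he']; split=> //; exists L'.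
  apply: next_list_ext nx' => v.
  rewrite take_size (big_seq_set +%R _ sup.1 (level_support sup e_gt0)) /=.
  by apply: eq_bigl => u; rewrite inE.
- split=> //; first by do 2 apply: at_time_nset => //.
  exists [::]; split=> //= [v|v|v|a ha]; rewrite ?take0 ?big_nil ?ltxx //.
    by rewrite fr // leq_addr.
  by apply: fr; lia.
Qed.

(** A vertex reached at time [t.+1] is an active vertex of time [t] or a neighbour of one, and
    [work t] counts these with multiplicity. *)
Lemma size_support_le t L : support t.+1 L -> (size L <= work t)%N.
Proof.
move=> [uL hm]; rewrite -(card_uniqP uL) -sum1_card big_mkcond /=.
have -> : work t = (\sum_v \sum_(u in level t e) ((u == v) + (0 < wt G u v)))%N.
  rewrite exchange_big; apply: eq_bigr => u _; rewrite big_split /= -add1n.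
  congr (_ + _)%N.
    by rewrite (bigD1 u) //= eqxx big1 // => v /negbTE; rewrite eq_sym => ->.
  rewrite /nnbr /nbrs size_filter -sum1_count big_enum_cond /= big_mkcond.
  by apply: eq_bigr => v _; case: (0 < _)%N.
apply: leq_sum => v _; case: ifP => // vL.
rewrite lt0n sum_nat_eq0; apply/negP => /forallP h.
have : 0 < twalk t.+1 v by rewrite -hm.
rewrite /= big1 ?ltxx // => u hu.
have /implyP := h u; rewrite inE hu => /(_ isT).
rewrite addn_eq0 !eqb0 => /andP[/negbTE uv]; rewrite -eqn0Ngt => /eqP w0.
by rewrite mxE uv w0 !mul0r addr0 mulr0.
Qed.

Lemma advance c t L L' s : at_time c t L s -> next_list t (twalk t.+1) L' s ->
  support t.+1 L' /\
  at_time c t.+1 L' (set_nmem (set_nmem s 5 (16 + t * n + n)) 6 (size L')).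
Proof.
move=> [h0 h3 h4 h5 h6 hl hv hp he] [h7 uL hm h0' hl' hv' hf].
split=> //; split=> //=; rewrite ?mulSn ?[(n + t * n)%N]addnC ?addnA //.
Qed.

Lemma at_time_tick c t L s : at_time c t L s ->
  at_time c.+1 t L (set_nmem s 4 c.+1).
Proof.
by move=> [h0 h3 h4 h5 h6 hl hv hp he]; split.
Qed.

(** A round costs at most [28 * D] for spreading and [(43 * N + 4) * D] for the tests; the constant
    50 absorbs the overhead. *)
Lemma cut_or_bound_spec D N T :
  (0 < D)%N -> (forall t, (work t <= D)%N) -> 1 <= e * g ^+ N ->
  ((forall t k, (0 < t <= l)%N -> e * g ^+ k < 1 -> passes t (e * g ^+ k)) ->
     ok Bound) ->
  (l * ((43 * N + 50) * D) + 20 <= T)%N ->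
  halt_prob G ok T (init G cut_or_bound i l alpha phi) = 1.
Proof.
move=> D0 wD hN hbound hT.
(* Every run halts by [FoundCut] or [DeclareBound], hence the postcondition [False]. *)
suff H : wp cut_or_bound (init_state G i l alpha phi)
    (l * ((43 * N + 50) * D) + 20)%N (fun=> False).
  by apply: (H [::] 0%N) => //; rewrite addn0.
rewrite /cut_or_bound.
apply: (wp_seq (w1 := 1)); [lia|]; apply: wp_nstore => //.
apply: (wp_seq (w1 := 1)); [lia|]; apply: wp_nstore => //.
apply: (wp_seq (w1 := 1)); [lia|]; apply: wp_rstore => //.
apply: (wp_seq (w1 := 1)); [lia|]; apply: wp_nstore => //.
apply: (wp_seq (w1 := 1)); [lia|]; apply: wp_rstore => //.
apply: (wp_seq (w1 := (l * ((43 * N + 50) * D) + 2)%N)); first lia.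
pose I t s := exists L, [/\ support t L, at_time t t L s, (size L <= D)%N,
  emitted s = [::] & (forall a, (16 + t * n + n <= a)%N -> rmem s a = 0) /\
  forall t' k, (0 < t' <= t)%N -> e * g ^+ k < 1 -> passes t' (e * g ^+ k)].
apply: (wp_for (N := l) (f := fun=> ((43 * N + 40) * D)%N) (I := I)).
- rewrite sum_nat_const_nat subn0.
  by apply: (@leq_ltn_trans (l * ((43 * N + 50) * D)))%N; [rewrite leq_mul2l;
      apply/orP; right; lia|lia].
- by move=> t s [L [_ h _ _ _]]; rewrite /= (at_t h) (at_l h).
- move=> t s tl [L [sup at_s LD he [fr hp]]].
  apply: (wp_seq (w1 := (28 * D)%N)); first by nia.
  apply: wp_weaken (spread_spec sup at_s fr D0 LD (wD t)) (leqnn _) _.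
  move=> s1 [at1 [L' nx1] he1].
  do 2 (apply: (wp_seq (w1 := 1)); [nia|]; apply: wp_nstore => //).
  rewrite /= (at_base at1) (at_n at1) /upd /= (next_size nx1).
  have [sup2 at2] := advance at1 nx1.
  have LD2 : (size L' <= D)%N := leq_trans (size_support_le sup2) (wD t).
  apply: wp_weaken (test_levels_spec sup2 at2 _ D0 LD2 (wD _) hN) _ _ => /=.
  + by rewrite he1.
  + by nia.
  move=> s3 [at3 hr3 he3 pass]; split; first by rewrite (at_t at3).
  exists L'; split=> //; first exact: at_time_tick.
  split=> [a ha|t' k /andP[t0]] /=.
    by rewrite hr3 ?(next_fresh nx1) //; move: ha; rewrite mulSn; lia.
  by rewrite leq_eqVlt ltnS => /orP[/eqP->|tt]; [exact: pass|apply: hp;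
      rewrite t0].
- move=> s [L [sup at_s LD he [fr hp]]]; apply: wp_declare_bound; first lia.
  exact: hbound.
- exists [:: i]; split=> //.
  + split=> // v; rewrite inE /=; case: eqP => _; by rewrite ?ltr01 ?ltxx.
  + split=> //=.
    * by case=> // _; rewrite mul0n addn0.
    * move=> v; rewrite mul0n addn0 /upd /=.
      rewrite eqn_add2l -(inj_eq val_inj) /=; by case: eqP.
  + split=> [a|t' k]; last by case: t'.
    rewrite mul0n addn0 => ha; rewrite /= /upd /= !ifN; last 2 first.
    * by apply/eqP; lia.
    * by apply/eqP; have := ltn_ord i; lia.
    by rewrite nth_default //=; lia.
Qed.

End Correctness.

(** * Numerical estimates *)

Section Estimates.
Variable R : realType.
Implicit Types (x y zeta tau phi : R).

(** From [1 - 1 / 2 <= expR (- (1 / 2))]. *)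
Lemma expR_half_le2 : expR (1 / 2) <= 2 :> R.
Proof.
have := expR_ge1Dx (- (1 / 2) : R); rewrite expRN => h.
have e0 := expR_gt0 (1 / 2 : R).
have : expR (1 / 2) * (expR (1 / 2))^-1 = 1 :> R by rewrite divff // gt_eqF.
by move=> h1; nra.
Qed.

Lemma le_expR x : x <= expR x.
Proof. by have := expR_ge1Dx x; lra. Qed.

(** Bernoulli's inequality; hence the thresholds at least double every [l] rounds. *)
Lemma expr_inv_succ_ge2 (l : nat) : (0 < l)%N -> 2 <= (1 + l%:R^-1 : R) ^+ l.
Proof.
move=> l0; have bernoulli (y : R) k : 0 <= y -> 1 + k%:R * y <= (1 + y) ^+ k.
  move=> y0; elim: k => [|k IH]; first by rewrite expr0; lra.
  rewrite exprS -natr1; have k0 : 0 <= k%:R :> R by [].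
  by apply: le_trans (ler_wpM2l _ IH); [nra|lra].
apply: le_trans (bernoulli _ _ _); last by rewrite invr_ge0.
by rewrite divff ?pnatr_eq0 -?lt0n.
Qed.

(** Keeps the loss of [l] successive roundings below a constant. *)
Lemma expr_inv_succ_le (l : nat) : (0 < l)%N ->
  (1 + l%:R^-1 : R) ^+ l <= expR 1.
Proof.
move=> l0; rewrite -[1 in leRHS](@divff _ l%:R) ?pnatr_eq0 -?lt0n // expRM_natl.
by rewrite lerXn2r ?nnegrE ?expR_ge0 ?expR_ge1Dx // addr_ge0 ?invr_ge0.
Qed.

Lemma walk_length_bounds zeta x (l : nat) : 0 < zeta -> zeta <= x ->
  `|l%:R - x / zeta| < 1 -> (0 < l)%N /\ l%:R <= 2 * x / zeta.
Proof.
move=> z0 zx; rewrite ltr_norml => /andP[h1 h2].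
have hz : 1 <= x / zeta by rewrite ler_pdivlMr ?mul1r.
split; first by rewrite -(ltr0n R); lra.
by rewrite -mulrA; lra.
Qed.

Lemma lam_expR zeta tau phi : 0 <= phi <= 1 / 2 ->
  - ln (1 / 2 * (Num.sqrt (1 - 2 * phi) + Num.sqrt (1 + 2 * phi))) = zeta * tau
      ->
  1 / 2 * (Num.sqrt (1 - 2 * phi) + Num.sqrt (1 + 2 * phi)) = expR (- (zeta *
      tau)).
Proof.
move=> /andP[p0 p1] <-; rewrite opprK lnK // posrE mulr_gt0 ?divr_gt0 //.
by rewrite ltr_wpDl ?sqrtr_ge0 // sqrtr_gt0; lra.
Qed.

(** By concavity the mean of the two roots is at most the root of 1, and this mean is
    [expR (- (zeta * tau))]. *)
Lemma rate_ge0 zeta tau phi : 0 <= phi <= 1 / 2 ->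
  - ln (1 / 2 * (Num.sqrt (1 - 2 * phi) + Num.sqrt (1 + 2 * phi))) = zeta * tau
      ->
  0 <= zeta * tau.
Proof.
move=> hp /(lam_expR hp) hl; have := expR_ge1Dx (- (zeta * tau)); rewrite -hl.
case/andP: hp => p0 p1.
have a0 : 0 <= 1 - 2 * phi by lra.
have b0 : 0 <= 1 + 2 * phi by lra.
have s01 : 0 <= (1 / 2 : R) <= 1 by lra.
have := sqrt_concave a0 b0 s01.
have -> : (1 - 1 / 2) * (1 - 2 * phi) + 1 / 2 * (1 + 2 * phi) = 1 by field.
by rewrite sqrtr1; lra.
Qed.

(* [x = ln m], [y = ln n]; [D] is the amount of work per level set, bounded both
   by the volume [l / alpha] and by the size [2 n^2] of the whole graph.  The
   second bound is the better one when [m] is a large power of [n]. *)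
Lemma time_bound zeta tau : 0 < zeta -> 0 < tau ->
  exists2 C : R, 0 <= C &
    forall x y (l J : nat) (D : R), 1 <= x -> 1 / 2 <= y -> (0 < l)%N -> 1 <= D
        ->
      l%:R <= 2 * x / zeta -> 1 <= (J%:R : R) <= 3 * x ->
      (x <= 4 / tau * y -> D <= l%:R * expR (tau * x)) ->
      (4 / tau * y < x -> D <= 2 * expR y ^+ 2) ->
      l%:R * ((43 * (l%:R * J%:R) + 50) * D) + 20 <= C * y ^+ 4 * expR (tau *
          x).
Proof.
(* [113 = 43 + 50 + 20], each term being a multiple of at most [l ^ 2 * J * D]; the other factors
   come from [l <= 2 * x / zeta] and [J <= 3 * x]. *)
move=> z0 t0; pose A : R := 113 * (2 / zeta) ^+ 2 * 3.
have A0 : 0 <= A by rewrite ?mulr_ge0 ?exprn_ge0 ?mulr_ge0 ?invr_ge0 ?(ltW z0).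
exists (A * (2 / zeta) * (4 / tau) ^+ 4 + A * 2 * (6 / tau) ^+ 3 * 16).
  by rewrite addr_ge0 ?mulr_ge0 ?exprn_ge0 ?mulr_ge0 ?invr_ge0 ?(ltW z0) ?(ltW
      t0).
move=> x y l J D x1 y1 l0 D1 hl /andP[J1 J3] hA hB.
have l1 : 1 <= l%:R :> R by rewrite ler1n.
have x0 : 0 <= x by lra.
have hl' : l%:R <= 2 / zeta * x by apply: le_trans hl _;
    rewrite le_eqVlt mulrAC eqxx.
have total : l%:R * ((43 * (l%:R * J%:R) + 50) * D) + 20 <= A * x ^+ 3 * D.
  apply: (@le_trans _ _ (113 * (l%:R ^+ 2 * J%:R * D))).
    have h1 : 1 <= l%:R * J%:R :> R by rewrite mulr_ege1.
    have h2 : l%:R * D <= l%:R * D * (l%:R * J%:R) :> R by rewrite ler_peMr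
        ?mulr_ge0 //; lra.
    have h3 : 1 <= l%:R * D by rewrite mulr_ege1.
    have h4 : l%:R * ((43 * (l%:R * J%:R) + 50) * D) =
              43 * (l%:R * D * (l%:R * J%:R)) + 50 * (l%:R * D) by ring.
    have h5 : l%:R ^+ 2 * J%:R * D = l%:R * D * (l%:R * J%:R) by ring.
    by rewrite h4 h5; lra.
  have -> : A * x ^+ 3 * D = 113 * ((2 / zeta * x) ^+ 2 * (3 * x) * D).
    by rewrite /A; ring.
  rewrite ler_wpM2l // ler_wpM2r ?(le_trans ler01) // ler_pM ?exprn_ge0 //.
  by rewrite lerXn2r ?nnegrE // mulr_ge0 // divr_ge0 // ltW.
apply: (le_trans total).
have E0 := expR_gt0 (tau * x).
have x30 : 0 <= A * x ^+ 3 by rewrite mulr_ge0 ?exprn_ge0.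
have y0 : 0 <= y by lra.
have y40 : 0 <= y ^+ 4 by rewrite exprn_ge0.
set C1 := A * (2 / zeta) * (4 / tau) ^+ 4.
set C2 := A * 2 * (6 / tau) ^+ 3 * 16.
have C10 : 0 <= C1 by rewrite /C1 ?mulr_ge0 ?exprn_ge0 ?mulr_ge0 ?invr_ge0
    ?(ltW z0) ?(ltW t0).
have C20 : 0 <= C2 by rewrite /C2 ?mulr_ge0 ?exprn_ge0 ?mulr_ge0 ?invr_ge0
    ?(ltW z0) ?(ltW t0).
have [xy|yx] := leP x (4 / tau * y).
  apply: (@le_trans _ _ (C1 * y ^+ 4 * expR (tau * x))); last first.
    by rewrite ler_wpM2r ?(ltW E0) // ler_wpM2r // lerDl.
  apply: le_trans (ler_wpM2l x30 (hA xy)) _;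
      rewrite mulrA ler_wpM2r ?(ltW E0) //.
  apply: le_trans (ler_wpM2l x30 hl') _.
  have -> : A * x ^+ 3 * (2 / zeta * x) = A * (2 / zeta) * x ^+ 4 by ring.
  have -> : C1 * y ^+ 4 = A * (2 / zeta) * (4 / tau * y) ^+ 4 by rewrite /C1;
      ring.
  rewrite ler_wpM2l // ?mulr_ge0 ?invr_ge0 ?(ltW z0) //.
  by rewrite lerXn2r ?nnegrE // mulr_ge0 // divr_ge0 // ltW.
apply: (@le_trans _ _ (C2 * y ^+ 4 * expR (tau * x))); last first.
  by rewrite ler_wpM2r ?(ltW E0) // ler_wpM2r // lerDr.
apply: le_trans (ler_wpM2l x30 (hB yx)) _.
(* In this case [n ^ 2] is at most [m ^ (tau / 2)]. *)
have yy : expR y ^+ 2 <= expR (tau / 2 * x).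
  rewrite -expRM_natl ler_expR.
  have : 4 / tau * y * tau < x * tau by rewrite ltr_pM2r.
  have -> : 4 / tau * y * tau = 4 * y by field; rewrite gt_eqF.
  by move=> ?; lra.
(* The other half of [m ^ tau] absorbs the powers of [ln m]. *)
have xx : x ^+ 3 <= (6 / tau) ^+ 3 * expR (tau / 2 * x).
  have -> : tau / 2 * x = 3%:R * (tau / 6 * x) by field.
  rewrite expRM_natl -exprMn lerXn2r ?nnegrE //.
    by rewrite mulr_ge0 ?expR_ge0 ?divr_ge0 // ltW.
  apply: (@le_trans _ _ (6 / tau * (tau / 6 * x))).
    by rewrite le_eqVlt; apply/orP; left; apply/eqP; field; rewrite gt_eqF.
  by rewrite ler_wpM2l ?le_expR // divr_ge0 // ltW.
(* The factor 16 in [C2] makes up for [y] being as small as [1 / 2]. *)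
have y16 : 1 <= 16 * y ^+ 4.
  have : (1 / 2) ^+ 4 <= y ^+ 4 by rewrite lerXn2r ?nnegrE ?divr_ge0.
  have -> : (1 / 2) ^+ 4 = 1 / 16 :> R by field.
  by lra.
have -> : expR (tau * x) = expR (tau / 2 * x) * expR (tau / 2 * x).
  by rewrite -expRD; congr expR; field.
set E := expR (tau / 2 * x) in xx yy *.
have E1 : 0 <= E by exact: expR_ge0.
apply: (@le_trans _ _ (A * ((6 / tau) ^+ 3 * E) * (2 * E))).
  apply: ler_pM => //; first by rewrite mulr_ge0 ?exprn_ge0 ?expR_ge0.
    by rewrite ler_wpM2l.
  by rewrite ler_wpM2l.
have -> : C2 * y ^+ 4 * (E * E) = A * ((6 / tau) ^+ 3 * E) * (2 * E) * (16 * y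
    ^+ 4).
  by rewrite /C2; ring.
have h6 : 0 <= (6 / tau) ^+ 3 by rewrite exprn_ge0 // divr_ge0 // ltW.
rewrite ler_peMr //; apply: mulr_ge0; last exact: mulr_ge0.
by apply: mulr_ge0 => //; exact: mulr_ge0.
Qed.

End Estimates.

(** * Bounds on the walk distribution and on the work *)

Section Bound.
Variables (R : realType) (n : nat) (G : wgraph n).
Hypothesis deg_gt0 : forall j : 'I_n, (0 < deg G j)%N.
Variables (i : 'I_n) (l : nat).

Lemma max_ratio_le (B : R) : 0 <= B ->
  (forall j, walk_dist R G i l 0 j <= B * ldeg R G j) -> max_ratio R G i l <= B.
Proof.
move=> B0 h; apply: bigmax_le => // j _.
by rewrite ler_pdivrMr ?h // (ldeg_gt0 R deg_gt0).
Qed.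

(** Serves the case [tau = 0], where [alpha = 1]. With truncation threshold [1 / (l + 1)], the
    truncated walk and the loss are each at most [ldeg]. *)
Lemma max_ratio_le2 : max_ratio R G i l <= 2.
Proof.
apply: max_ratio_le => // j.
have e0 : 0 < l.+1%:R^-1 :> R by rewrite invr_gt0 ltr0n.
apply: le_trans (walk_dist_le deg_gt0 i e0 l j) _.
have := twalk_le1 deg_gt0 i (l.+1%:R^-1 : R) l j.
have d1 := ldeg_ge1 R deg_gt0 j.
have : l%:R * l.+1%:R^-1 <= 1 :> R by rewrite ler_pdivrMr ?ltr0n // mul1r
    ler_nat.
move=> /(ler_wpM2r (le_trans ler01 d1)); rewrite mul1r => h1 h2.
by apply: le_trans (lerD h2 h1) _; lra.
Qed.

(** Rounding costs at most [expR 1], and [lam ^ l <= expR (1 / 8) * alpha] because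
    [l > x / zeta - 1]. As [expR (9 / 8) <= 16], the truncated ratio is at most [16 * alpha]; the
    truncation at time [l] and the earlier losses add at most [alpha] each. *)
Lemma max_ratio_le_alpha (zeta tau phi alpha : R) (x : R) (N : nat) :
  0 < zeta -> zeta * tau < 1 / 8 -> 0 <= phi <= 1 / 2 ->
  - ln (1 / 2 * (Num.sqrt (1 - 2 * phi) + Num.sqrt (1 + 2 * phi))) = zeta * tau
      ->
  (0 < l)%N -> `|l%:R - x / zeta| < 1 -> alpha = expR (- (tau * x)) ->
  1 <= alpha / l%:R * (1 + l%:R^-1) ^+ N ->
  (forall t k, (0 < t <= l)%N -> alpha / l%:R * (1 + l%:R^-1) ^+ k < 1 ->
     passes G i l alpha phi t (alpha / l%:R * (1 + l%:R^-1) ^+ k)) ->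
  max_ratio R G i l <= 256 * alpha.
Proof.
move=> z0 zt hp hphi l0 hl aE hN pass.
have a0 : 0 < alpha by rewrite aE expR_gt0.
have l1 : 1 <= l%:R :> R by rewrite ler1n.
have lp : 0 < l%:R :> R by lra.
set e := alpha / l%:R in hN pass; have e0 : 0 < e by rewrite divr_gt0.
have le_a : l%:R * e = alpha by rewrite /e mulrC divfK // gt_eqF.
have ea : e <= alpha by rewrite -le_a ler_peMl // ltW.
apply: max_ratio_le => [|j]; first by rewrite mulr_ge0 // ltW.
have d0 := ldeg_gt0 R deg_gt0 j; have d1 := ldeg_ge1 R deg_gt0 j.
apply: le_trans (walk_dist_le deg_gt0 i e0 l j) _; rewrite le_a.
have tw := twalk_le_truncated deg_gt0 i e0 l j.
suff : truncated G i e l j <= 16 * alpha * ldeg R G j by move=> ?; nra.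
have g1 : 1 <= 1 + l%:R^-1 :> R by rewrite lerDl invr_ge0.
(* The fractional set is the single vertex [j]. *)
have := @truncated_le_sqrt R n G deg_gt0 i e e0 _ N g1 l phi _ hp
          (esym (lam_expR hp hphi)) hN pass
          (fun k => (k == j)%:R).
do 2 (rewrite (bigD1 j) //= eqxx mul1r big1 ?addr0; last first;
  first by move=> k /negbTE->; rewrite mul0r).
move=> h; apply: le_trans (h _) _ => {h}; first by move=> k; case: (k == j);
    rewrite /= ?lexx ?ler01.
have sq : Num.sqrt (ldeg R G j) <= ldeg R G j.
  rewrite -[leRHS]ger0_norm ?(ltW d0) // -sqrtr_sqr ler_wsqrtr // expr2.
  by rewrite ler_peMl // ltW.
rewrite ler_pM ?sqrtr_ge0 //.
  rewrite exprn_ge0 // mulr_ge0 //; first by rewrite (le_trans ler01).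
  exact: expR_ge0.
rewrite exprMn -expRM_natl.
apply: (@le_trans _ _ (expR 1 * (expR (1 / 8) * alpha))).
  rewrite ler_pM ?expr_inv_succ_le ?expR_ge0 ?exprn_ge0 ?(le_trans ler01) //.
  rewrite aE -expRD ler_expR.
  move: hl; rewrite ltr_norml => /andP[h1 _].
  have zt0 := rate_ge0 hp hphi.
  have -> : tau * x = zeta * tau * (x / zeta) by field; rewrite gt_eqF.
  by nra.
rewrite mulrA ler_wpM2r ?(ltW a0) // -expRD.
apply: (@le_trans _ _ (expR (4%:R * (1 / 2)))); first by rewrite ler_expR; lra.
rewrite expRM_natl; apply: (@le_trans _ _ (2 ^+ 4));
    last by rewrite -natrX ler_nat.
by rewrite lerXn2r ?nnegrE ?expR_ge0 ?expR_half_le2.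
Qed.

Lemma nnbr_le (u : 'I_n) : (nnbr G u <= deg G u)%N.
Proof.
rewrite /nnbr /nbrs size_filter -sum1_count big_enum_cond /= big_mkcond.
by apply: leq_sum => v _; case: ifP.
Qed.

(** Weights of edges are positive integers, so a vertex has at most [deg] neighbours and its share
    of the work is at most [2 * deg]. *)
Lemma work_le_vol (alpha : R) t : 0 < alpha / l%:R ->
  (work G i l alpha t)%:R <= (alpha / l%:R)^-1 :> R.
Proof.
move=> e0; apply: (@le_trans _ _ (vol' G (level G i (alpha / l%:R) t (alpha /
    l%:R)))%:R).
  rewrite ler_nat /work /vol' big_distrr /=; apply: leq_sum => u _.
  by have := nnbr_le u; have := deg_gt0 u; lia.
by rewrite -[leRHS]mul1r ler_pdivlMr // mulrC vol'_level_le // ltW.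
Qed.

Lemma work_le_graph (alpha : R) t : (work G i l alpha t <= 2 * n ^ 2)%N.
Proof.
have n0 : (0 < n)%N := leq_ltn_trans (leq0n i) (ltn_ord i).
apply: (@leq_trans (\sum_(u < n) n.+1)%N); last first.
  by rewrite sum_nat_const card_ord; nia.
rewrite /work [leqLHS]big_mkcond; apply: leq_sum => u _; case: ifP => // _.
rewrite ltnS /nnbr /nbrs size_filter (leq_trans (count_size _ _)) //.
by rewrite size_enum_ord.
Qed.

Lemma le_total_deg : (n <= total_deg G)%N.
Proof.
rewrite -[leqLHS]card_ord -sum1_card /total_deg; apply: leq_sum => j _.
exact: deg_gt0.
Qed.

End Bound.

(** * Choice of the parameters and conclusion *)

Local Open Scope classical_set_scope.

(** Allows a failure probability [eps] equal to 1 for finitely many small [n]. *)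
Lemma eventually_zero_cvg (R : realType) (N : nat) :
  (fun n => (n < N)%N%:R : R) @ \oo --> (0 : R).
Proof.
by apply: cvg_near_cst; exists N => // n /= Nn; rewrite ltnNge Nn.
Qed.

Theorem theorem2 (R : realType) (zeta tau phi : R)
  (hzeta : 0 < zeta) (htau : tau < 1) (hzt : zeta * tau < 1 / 8)
  (hphi01 : 0 <= phi <= 1 / 2)
  (hphi : - ln (1 / 2 * (Num.sqrt (1 - 2 * phi) + Num.sqrt (1 + 2 * phi)))
          = zeta * tau) :
  exists (prg : cmd) (C : R) (eps : nat -> R),
    eps @ \oo --> (0 : R) /\
    forall (n : nat) (G : wgraph n) (i : 'I_n) (l : nat) (alpha : R),
      (forall j : 'I_n, (0 < deg G j)%N) ->
      `|l%:R - ln (total_deg G)%:R / zeta| < 1 ->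
      alpha = (total_deg G)%:R `^ (- tau) ->
      exists T : nat,
        T%:R <= C * (ln n%:R) ^+ 4 / alpha /\
        1 - eps n <=
          halt_prob G (correct G i l alpha phi) T (init G prg i l alpha phi).
Proof.
have tau0 : 0 <= tau by have := rate_ge0 hphi01 hphi; rewrite pmulr_rge0.
have small (C : R) n (alpha : R) : 0 <= C -> 0 <= alpha ->
    0 <= C * (ln n%:R) ^+ 4 / alpha.
  by move=> C0 a0; rewrite divr_ge0 // mulr_ge0 // exprn_even_ge0.
have ln_half n : (2 <= n)%N -> 1 / 2 <= ln n%:R :> R.
  move=> n2; rewrite -ler_expR lnK; last by rewrite posrE ltr0n; lia.
  by apply: le_trans (expR_half_le2 R) _; rewrite ler_nat.
have [tau_eq0|tau_neq0] := eqVneq tau 0.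
  (* For [n >= 2] the bound [16 * ln n ^ 4] is at least 1, the time taken by [DeclareBound]. *)
  exists DeclareBound, 16, (fun n => (n < 2)%N%:R); split.
    exact: eventually_zero_cvg.
  move=> n G i l alpha hdeg _; rewrite tau_eq0 oppr0 powRr0 => ->.
  have [n2|n2] := ltnP n 2.
    by exists 0%N; split; [exact: small|rewrite /= subrr].
  exists 1%N; split.
    rewrite divr1; have h : 1 / 2 <= ln n%:R := ln_half _ n2.
    have : (1 / 2) ^+ 4 <= (ln n%:R) ^+ 4 :> R.
      by rewrite lerXn2r ?nnegrE ?divr_ge0 // (le_trans _ h) // divr_ge0.
    have -> : (1 / 2) ^+ 4 = 1 / 16 :> R by field.
    by move: (ln _ ^+ 4) => y; lra.
  rewrite /= big_seq1 /= mul1r subr0 (le_trans (max_ratio_le2 R hdeg i l))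
      ?lexx //.
  by rewrite mulr1 ler_nat.
have {tau_neq0}tau_gt0 : 0 < tau by rewrite lt_neqAle eq_sym tau_neq0.
have [C C0 hC] := time_bound hzeta tau_gt0.
(* [m ^ (1 - tau)] is [expR (s * x) ^ 2]; [X0] makes one factor exceed [2 / zeta / s], and also
   gives [x >= zeta] and [x >= 1]. *)
pose s := (1 - tau) / 2; have s0 : 0 < s by rewrite divr_gt0 // subr_gt0.
pose X0 := 2 / zeta / s / s + zeta + 1.
have X0_ge0 : 0 <= 2 / zeta / s / s by do 3 (apply: divr_ge0; last exact: ltW).
pose N0 := Num.bound (expR X0).
exists cut_or_bound, C, (fun n => (n < N0)%N%:R); split.
  exact: eventually_zero_cvg.
move=> n G i l alpha hdeg hl halpha.
have [nN|nN] := ltnP n N0.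
  exists 0%N; split; last by rewrite /= subrr.
  by apply: small; rewrite ?halpha ?powR_ge0.
pose m : R := (total_deg G)%:R; pose x := ln m; pose y : R := ln n%:R.
have nX : expR X0 <= n%:R.
  by rewrite (le_trans (ltW (archi_boundP (expR_ge0 X0)))) // ler_nat.
have nm : n%:R <= m by rewrite ler_nat le_total_deg.
have n0 : 0 < n%:R :> R by rewrite (lt_le_trans (expR_gt0 _) nX).
have m0 : 0 < m by rewrite (lt_le_trans n0).
have mE : expR x = m by rewrite lnK ?posrE.
have nE : expR y = n%:R by rewrite lnK ?posrE.
have xX : X0 <= x by rewrite -ler_expR mE (le_trans nX).
have x1 : 1 <= x by move: xX; rewrite /X0; lra.
have zx : zeta <= x by move: xX; rewrite /X0; lra.
have n2 : (2 <= n)%N.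
  rewrite -(ler_nat R) (le_trans _ nX) // (le_trans _ (expR_ge1Dx X0)) //.
  by rewrite /X0; lra.
have y1 : 1 / 2 <= y := ln_half _ n2.
have aE : alpha = expR (- (tau * x)).
  by rewrite halpha /powR gt_eqF // mulNr.
have a0 : 0 < alpha by rewrite aE expR_gt0.
have aV : alpha^-1 = expR (tau * x) by rewrite aE expRN invrK.
have [l0 l2] := walk_length_bounds hzeta zx hl.
have lp : 0 < l%:R :> R by rewrite ltr0n.
have e0 : 0 < alpha / l%:R by rewrite divr_gt0.
have eV : (alpha / l%:R)^-1 = l%:R * expR (tau * x).
  by rewrite invfM invrK aV mulrC.
(* The volume bound [l / alpha] of level sets must not exceed [m]: this is where [tau < 1] enters.
   One factor [expR (s * x)] beats the constant, the other [s * x] itself. *)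
have em : 1 <= alpha / l%:R * m.
  rewrite -ler_pdivrMl // mulr1 eV -mE.
  have -> : expR x = expR (s * x) * expR (s * x) * expR (tau * x).
    by rewrite -!expRD; congr expR; rewrite /s; field.
  rewrite ler_wpM2r ?expR_ge0 // (le_trans l2) //.
  have sx : 2 / zeta / s <= expR (s * x).
    apply: le_trans (le_expR _); rewrite [s * x]mulrC -ler_pdivrMr //.
    by apply: le_trans xX; rewrite /X0; lra.
  have -> : 2 * x / zeta = 2 / zeta / s * (s * x) by field; rewrite !gt_eqF.
  apply: ler_pM => //; last exact: le_expR.
    by do 2 (apply: divr_ge0; last exact: ltW).
  by apply: mulr_ge0; [exact: ltW|lra].
(* [2 ^ J >= expR (J / 2) >= m], so [l * J] rounds raise the threshold from [alpha / l] to at least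
   1. *)
pose J := (Num.truncn (2 * x)).+1.
have [J1 J2] : 2 * x <= J%:R /\ 1 <= (J%:R : R) <= 3 * x.
  have x20 : 0 <= 2 * x by lra.
  have /andP[h1 h2] := truncn_itv x20; split; first exact: ltW.
  by rewrite ler1n /= /J -natr1; lra.
have hN : 1 <= alpha / l%:R * (1 + l%:R^-1) ^+ (l * J).
  apply: le_trans em _; rewrite ler_wpM2l ?(ltW e0) // -mE exprM.
  apply: (@le_trans _ _ (2 ^+ J)).
    apply: (@le_trans _ _ (expR (1 / 2) ^+ J)).
      by rewrite -expRM_natl ler_expR; lra.
    by rewrite lerXn2r ?nnegrE ?expR_ge0 ?expR_half_le2.
  rewrite lerXn2r ?nnegrE ?expr_inv_succ_ge2 //.
  by rewrite exprn_ge0 // addr_ge0 ?invr_ge0.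
(* The volume bounds the work if [m <= n ^ (4 / tau)], the size of the graph otherwise. *)
have [D [D0 hwork DA DB]] : exists D : nat, [/\ (0 < D)%N,
    forall t, (work G i l alpha t <= D)%N,
    x <= 4 / tau * y -> D%:R <= l%:R * expR (tau * x) &
    4 / tau * y < x -> D%:R <= 2 * expR y ^+ 2].
  have [xy|yx] := leP x (4 / tau * y).
    have eV0 : 0 <= (alpha / l%:R)^-1 by rewrite invr_ge0 ltW.
    exists (Num.truncn (alpha / l%:R)^-1); split=> // [|t|_].
    - rewrite truncn_ge_nat // eV.
      rewrite mulr_ege1 ?ler1n // -expR0 ler_expR mulr_ge0 //; lra.
    - by rewrite truncn_ge_nat // work_le_vol.
    - by rewrite -eV; case/andP: (truncn_itv eV0).
  exists (2 * n ^ 2)%N; split=> // [|t|_].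
  - by rewrite muln_gt0 /= expn_gt0 (leq_trans _ n2).
  - exact: work_le_graph.
  - by rewrite nE natrM natrX.
exists (l * ((43 * (l * J) + 50) * D) + 20)%N; split.
  rewrite aV natrD !natrM natrD !natrM; apply: hC => //.
  by rewrite ler1n.
rewrite (cut_or_bound_spec hdeg e0 em D0 hwork hN) // ?gerBl ?ler0n // => pass.
exact: (max_ratio_le_alpha hdeg hzeta hzt hphi01 hphi l0 hl aE hN pass).
Qed.
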